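(* Let $n\ge 2$ and let $\Omega\subset\mathbb{R}^n$ be a bounded domain. If $\Omega$ is an $\dot M^{s,\,n/s}_{\mathrm{ball}}$-extension domain for some $s\in(0,1]$, then $\Omega$ has the LLC property.
   Context: Hajłasz spaces. Let $\Omega\subset\mathbb{R}^n$ be a domain, $s\in(0,1]$, $p\in(0,\infty]$. For a measurable function $u$ on $\Omega$, $\mathcal{D}^s_{\mathrm{ball}}(u)$ denotes the collection of all nonnegative measurable functions $g$ on $\Omega$ for which there is a set $E\subset\Omega$ with $|E|=0$ such that $$|u(x)-u(y)|\le |x-y|^s[g(x)+g(y)]$$ for all $x,y\in\Omega\setminus E$ satisfying $|x-y|<\frac12\operatorname{dist}(x,\partial\Omega)$. When $\Omega=\mathbb{R}^n$, $\operatorname{dist}(x,\partial\Omega)=\infty$, so there is no restriction on $x,y$. The space $\dot M^{s,p}_{\mathrm{ball}}(\Omega)$ consists of all measurable $u$ with $\|u\|_{\dot M^{s,p}_{\mathrm{ball}}(\Omega)}:=\inf_{g\in\mathcal{D}^s_{\mathrm{ball}}(u)}\|g\|_{L^p(\Omega)}<\infty$. Extension domain. $\Omega$ is an $\dot M^{s,p}_{\mathrm{ball}}$-extension domain if $\dot M^{s,p}_{\mathrm{ball}}(\Omega)=\dot M^{s,p}_{\mathrm{ball}}(\mathbb{R}^n)|_\Omega$ with equivalent norms, where for a function space $X(\mathbb{R}^n)$ one sets $X(\mathbb{R}^n)|_\Omega:=\{u|_\Omega: u\in X(\mathbb{R}^n)\}$ and $\|v\|_{X(\mathbb{R}^n)|_\Omega}:=\inf\{\|u\|_{X(\mathbb{R}^n)}: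 u\in X(\mathbb{R}^n),\ u|_\Omega=v\}$. LLC property. A domain $\Omega\subset\mathbb{R}^n$ has the linear local connectivity (LLC) property if there exists a constant $b\in(0,1]$ such that for all $z\in\mathbb{R}^n$ and $r>0$: (LLC(1)) any two points of $\Omega\cap B(z,r)$ can be joined by a curve in $\Omega\cap B(z,r/b)$; and (LLC(2)) any two points of $\Omega\setminus B(z,r)$ can be joined by a curve in $\Omega\setminus B(z,br)$. *)

(* Defs.v *)
From HB Require Import structures.
From mathcomp Require Import all_boot all_order all_algebra.
From mathcomp Require Import all_classical all_reals all_analysis.

Set Implicit Arguments.
Unset Strict Implicit.
Unset Printing Implicit Defensive.

Import Order.TTheory GRing.Theory Num.Theory.
Import numFieldNormedType.Exports.

Local Open Scope classical_set_scope.
Local Open Scope ring_scope.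

(* R^n is 'rV[R]_n. Its library norm is the sup norm, which induces the usual
   topology and the usual bounded sets; distances and balls below are however
   Euclidean. *)
Definition eucl_dist (R : realType) (n : nat) (x y : 'rV[R]_n) : R :=
  Num.sqrt (\sum_(i < n) (x 0 i - y 0 i) ^+ 2).

Definition eucl_ball (R : realType) (n : nat) (z : 'rV[R]_n) (r : R) :
    set 'rV[R]_n :=
  [set x | eucl_dist x z < r].

Definition domain (R : realType) (n : nat) (Omega : set 'rV[R]_n) : Prop :=
  [/\ open Omega, connected Omega & Omega !=set0].

(* n-dimensional Lebesgue measure: the Caratheodory restriction of the outer
   measure given by countable covers by half-open boxes. A pair of corners
   (a, b) stands for the box \prod_i ]a_i, b_i]. *)
Definition box (R : realType) (n : nat) (c : 'rV[R]_n * 'rV[R]_n) :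
    set 'rV[R]_n :=
  [set x | forall i : 'I_n, x 0 i \in `]c.1 0 i, c.2 0 i]].

Definition box_volume (R : realType) (n : nat) (c : 'rV[R]_n * 'rV[R]_n) : R :=
  \prod_(i < n) Num.max 0 (c.2 0 i - c.1 0 i).

Definition lebesgue_outer (R : realType) (n : nat) (A : set 'rV[R]_n) :
    \bar R :=
  ereal_inf [set (\esum_(c in C) (box_volume c)%:E)%E
    | C in [set C | countable C /\ A `<=` \bigcup_(c in C) box c]].

Section lebesgue_outer_measure.
Variables (R : realType) (n : nat).
Local Open Scope ereal_scope.

Lemma box_volume_ge0 (c : 'rV[R]_n * 'rV[R]_n) : 0 <= (box_volume c)%:E.
Proof. by rewrite lee_fin prodr_ge0// => i _; rewrite le_max lexx. Qed.

Lemma lebesgue_outer0 : @lebesgue_outer R n set0 = 0.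
Proof.
apply/eqP; rewrite eq_le; apply/andP; split.
  by apply: ereal_inf_lbound; exists set0; [split|rewrite esum_set0].
apply: le_ereal_inf_tmp => _ [C _ <-].
by apply: esum_ge0 => c _; exact: box_volume_ge0.
Qed.

Lemma lebesgue_outer_ge0 (A : set 'rV[R]_n) : 0 <= lebesgue_outer A.
Proof.
apply: le_ereal_inf_tmp => _ [C _ <-].
by apply: esum_ge0 => c _; exact: box_volume_ge0.
Qed.

Lemma le_lebesgue_outer :
  {homo @lebesgue_outer R n : A B / A `<=` B >-> A <= B}.
Proof.
move=> A B AB; apply/ereal_inf_le_tmp => x [C [cC BC] <-].
by exists C => //; split => //; exact: subset_trans AB BC.
Qed.

Lemma lebesgue_outer_sigma_subadditive :
  sigma_subadditive (@lebesgue_outer R n).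
Proof.
move=> A.
have [[i ioo]|] := pselect (exists i, lebesgue_outer (A i) = +oo).
  rewrite (eseries_pinfty _ _ ioo) ?leey// => k _.
  by rewrite -ltNye (lt_le_trans _ (lebesgue_outer_ge0 _)).
rewrite -forallNE => Aoo.
apply/lee_addgt0Pr => e e0.
rewrite (le_trans _ (epsilon_trick _ _ (ltW e0)))//; last first.
  by move=> k; exact: lebesgue_outer_ge0.
pose P k (C : set ('rV[R]_n * 'rV[R]_n)) :=
  (countable C /\ A k `<=` \bigcup_(c in C) box c) /\
  \esum_(c in C) (box_volume c)%:E <=
    lebesgue_outer (A k) + (e / (2 ^ k.+1)%:R)%:E.
have [G PG] : {G : nat -> set ('rV[R]_n * 'rV[R]_n) & forall k, P k (G k)}.
  apply: (@choice _ _ P) => k.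
  have ek : (0 < e / (2 ^ k.+1)%:R)%R by rewrite divr_gt0// ltr0n expn_gt0.
  have fk : lebesgue_outer (A k) \is a fin_num.
    rewrite ge0_fin_numE ?lebesgue_outer_ge0// ltey; exact/eqP/Aoo.
  have [_ [C CA <-] /ltW h] := lb_ereal_inf_adherent ek fk.
  by exists C.
apply: (@le_trans _ _ (\esum_(c in \bigcup_k G k) (box_volume c)%:E)).
  apply: ereal_inf_lbound; exists (\bigcup_k G k) => //; split.
    by apply: bigcup_countable => // k _; exact: (PG k).1.1.
  move=> x [k _ /(PG k).1.2 [c Gc xc]]; exists c => //; by exists k.
rewrite seqDU_bigcup_eq esum_bigcupT; last 2 first.
- exact: trivIset_seqDU.
- exact: box_volume_ge0.
rewrite -nneseries_esumT; last first.
  by move=> k; apply: esum_ge0 => c _; exact: box_volume_ge0.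
apply: lee_nneseries => k _.
  by move=> _; apply: esum_ge0 => c _; exact: box_volume_ge0.
apply: le_trans (PG k).2.
rewrite esum_mkcond [leRHS]esum_mkcond; apply: le_esum => c _.
case: ifPn => [cG|_].
  by rewrite mem_set//; apply: subset_seqDU (set_mem cG).
by case: ifPn => // _; exact: box_volume_ge0.
Qed.

HB.instance Definition _ := isOuterMeasure.Build R 'rV[R]_n
  (@lebesgue_outer R n) lebesgue_outer0 lebesgue_outer_ge0 le_lebesgue_outer
  lebesgue_outer_sigma_subadditive.

End lebesgue_outer_measure.

(* A copy of 'rV[R]_n equipped with the sigma-algebra of Lebesgue measurable
   sets. *)
Definition lebesgueRn (R : realType) (n : nat) :=
  caratheodory_type (@lebesgue_outer R n).

HB.instance Definition _ (R : realType) (n : nat) :=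
  Measurable.on (@lebesgueRn R n).

Definition lebesgue_measureRn (R : realType) (n : nat) :
    set (lebesgueRn R n) -> \bar R :=
  @lebesgue_outer R n.

HB.instance Definition _ (R : realType) (n : nat) :=
  isMeasure.Build _ (lebesgueRn R n) R (@lebesgue_measureRn R n)
    (@lebesgue_outer0 R n) (@lebesgue_outer_ge0 R n)
    (@caratheodory_measure_sigma_additive R 'rV[R]_n (@lebesgue_outer R n)).

(* Functions on Omega are represented by total functions, of which only the
   values on Omega are ever used. *)
Definition measurable_on (R : realType) (n : nat) (Omega : set 'rV[R]_n)
    (u : 'rV[R]_n -> R) : Prop :=
  measurable_fun (Omega : set (lebesgueRn R n)) (u : lebesgueRn R n -> R).

Definition Lp_norm (R : realType) (n : nat) (p : \bar R)
    (Omega : set 'rV[R]_n) (g : 'rV[R]_n -> R) : \bar R :=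
  Lnorm (@lebesgue_measureRn R n) p (EFin \o (g \_ Omega)).

(* This is +oo when Omega has empty boundary. *)
Definition dist_boundary (R : realType) (n : nat) (Omega : set 'rV[R]_n)
    (x : 'rV[R]_n) : \bar R :=
  ereal_inf [set (eucl_dist x y)%:E | y in closure Omega `\` interior Omega].

Definition Dball (R : realType) (n : nat) (s : R) (Omega : set 'rV[R]_n)
    (u : 'rV[R]_n -> R) : set ('rV[R]_n -> R) :=
  [set g | [/\ forall x, Omega x -> 0 <= g x,
     measurable_on Omega g &
     exists E : set 'rV[R]_n,
       [/\ E `<=` Omega, @lebesgue_measureRn R n E = 0%E &
         forall x y, (Omega `\` E) x -> (Omega `\` E) y ->
           ((eucl_dist x y)%:E < (2^-1)%:E * dist_boundary Omega x)%E ->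
           `|u x - u y| <= eucl_dist x y `^ s * (g x + g y)]]].

Definition Mball_norm (R : realType) (n : nat) (s : R) (p : \bar R)
    (Omega : set 'rV[R]_n) (u : 'rV[R]_n -> R) : \bar R :=
  ereal_inf [set Lp_norm p Omega g | g in Dball s Omega u].

Definition Mball (R : realType) (n : nat) (s : R) (p : \bar R)
    (Omega : set 'rV[R]_n) : set ('rV[R]_n -> R) :=
  [set u | measurable_on Omega u /\ (Mball_norm s p Omega u < +oo)%E].

Definition Mball_extensions (R : realType) (n : nat) (s : R) (p : \bar R)
    (Omega : set 'rV[R]_n) (v : 'rV[R]_n -> R) : set ('rV[R]_n -> R) :=
  [set u | Mball s p [set: 'rV[R]_n] u /\ forall x, Omega x -> u x = v x].

Definition Mball_restr (R : realType) (n : nat) (s : R) (p : \bar R)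
    (Omega : set 'rV[R]_n) : set ('rV[R]_n -> R) :=
  [set v | Mball_extensions s p Omega v !=set0].

Definition Mball_restr_norm (R : realType) (n : nat) (s : R) (p : \bar R)
    (Omega : set 'rV[R]_n) (v : 'rV[R]_n -> R) : \bar R :=
  ereal_inf [set Mball_norm s p [set: 'rV[R]_n] u
    | u in Mball_extensions s p Omega v].

Definition Mball_extension_domain (R : realType) (n : nat) (s : R)
    (p : \bar R) (Omega : set 'rV[R]_n) : Prop :=
  Mball s p Omega = Mball_restr s p Omega /\
  exists C : R, 0 < C /\
    forall v, Mball s p Omega v ->
      (Mball_norm s p Omega v <= C%:E * Mball_restr_norm s p Omega v)%E /\
      (Mball_restr_norm s p Omega v <= C%:E * Mball_norm s p Omega v)%E.

Definition joined_in (R : realType) (n : nat) (A : set 'rV[R]_n)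
    (x y : 'rV[R]_n) : Prop :=
  exists gamma : R -> 'rV[R]_n,
    [/\ {within `[0, 1], continuous gamma}, gamma 0 = x, gamma 1 = y &
        forall t, t \in `[0, 1] -> A (gamma t)].

Definition LLC (R : realType) (n : nat) (Omega : set 'rV[R]_n) : Prop :=
  exists b : R, 0 < b <= 1 /\
    forall (z : 'rV[R]_n) (r : R), 0 < r ->
      (forall x y, (Omega `&` eucl_ball z r) x -> (Omega `&` eucl_ball z r) y ->
         joined_in (Omega `&` eucl_ball z (r / b)) x y) /\
      (forall x y, (Omega `\` eucl_ball z r) x -> (Omega `\` eucl_ball z r) y ->
         joined_in (Omega `\` eucl_ball z (b * r)) x y).

(* Main.v *)
Require Import Defs.
From mathcomp Require Import all_boot all_order all_algebra.
From mathcomp Require Import all_classical all_reals all_analysis.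
From mathcomp Require Import measurable_realfun ring lra.

(* Write p = n/s and suppose two points of Omega cannot be joined inside a large
   concentric ball (respectively outside a small one). On the component of one
   of them, take the logarithmic cutoff between the radii r and 2^N r, and 0 on
   the rest of Omega. Its Hajlasz gradient
     (s N log 2)^-1 max(|x - z|, r)^-s
   has p-energy of order N^(1-p), hence small since p >= 2; so an extension to
   R^n has a Hajlasz gradient of small p-energy. But the extension equals 1 near
   some point and 0 near some point of every sphere around z with radius in an
   interval (2h, 4h), and this bounds the energy from below: a bisection finds a
   radius around which thin annuli carry geometrically small energy, and chains
   of balls shrinking to the two points on that sphere compare the values 0
   and 1. *)

Set Implicit Arguments.
Unset Strict Implicit.
Unset Printing Implicit Defensive.

Import Order.TTheory GRing.Theory Num.Theory.
Import numFieldNormedType.Exports.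

Local Open Scope classical_set_scope.
Local Open Scope ring_scope.

(** * Curves *)

(** The exponent [n / s] makes everything scale invariant: a Hajlasz gradient of size
    [kappa * rho ^ -s] on a ball of radius [rho] has [p]-energy of order [kappa ^ p], whatever
    [rho]. Hence [N] depends only on [n], [s] and the norm constant of the extension, not on [z] and
    [r]. The cutoff may jump between components, yet on [Omega] this costs nothing: the inequality
    is tested only when [|x - y|] is less than half the distance of [x] to the boundary. Such a pair
    is joined inside [Omega] near [x], so either it lies in one component or one of its points is
    where the cutoff vanishes. On the whole space that restriction disappears, and the extension has
    to pay for the jump. The obstacle to the lower bound is that the exponent is critical and the
    inequality holds only off a null set: the extension has no controlled value at a given point,
    and in a chain of shrinking balls every scale could contribute equally. So the values 0 and 1
    are prescribed on open neighbourhoods, inside which a chain ends after finitely many balls, and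
    on a whole interval of radii, which leaves the freedom to pick one where the energy decays with
    the scale. *)

Section paths.
Variables (R : realType) (n : nat).
Implicit Types (A V : set 'rV[R]_n) (x y w q : 'rV[R]_n).

Let clip (t : R) := Num.max 0 (Num.min t 1).

Let clipI t : clip t \in `[0, 1].
Proof. by rewrite in_itv/= le_max lexx ge_max ler01 ge_min lexx orbT. Qed.

Let clip_continuous : continuous clip.
Proof.
have -> : clip = (cst (0 : R^o)) \max ((id : R -> R^o) \min (cst (1 : R^o))) by apply/funext.
move=> t; apply: continuous_max; first exact: cst_continuous.
by apply: continuous_min; [exact: cvg_id|exact: cst_continuous].
Qed.

Let clip_comp_continuous (T : topologicalType) (h : R -> T) (k : R -> R) :
  {within `[0, 1], continuous h} -> continuous k -> continuous (h \o clip \o k).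
Proof.
move=> /subspace_continuousP ch ck t P /(ch _ (clipI _)) /= hP.
have nb : \forall u \near t, clip (k u) \in `[0, 1] -> P (h (clip (k u))).
  exact: (continuous_comp (ck t) (@clip_continuous (k t))) hP.
change (\forall u \near t, P (h (clip (k u)))).
by apply: filterS nb => u; apply.
Qed.

(** Precomposing with the retraction [clip] of the line onto [[0, 1]] makes a curve globally
    continuous, so later constructions avoid the subspace topology. *)
Lemma joined_inP A x y : joined_in A x y <->
  exists f : R -> 'rV[R]_n, [/\ continuous f, f 0 = x, f 1 = y & forall t, A (f t)].
Proof.
split=> [[f [cf f0 f1 Af]]|[f [cf f0 f1 Af]]]; last first.
  by exists f; split => //; exact: continuous_subspaceT.
exists (f \o clip); split => /=.
- by apply: (@clip_comp_continuous _ f id) => // t; exact: cvg_id.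
- by rewrite /clip min_l ?ler01// maxxx.
- by rewrite /clip minxx max_r ?ler01.
- by move=> t; apply: Af; exact: clipI.
Qed.

Lemma joined_in_refl A x : A x -> joined_in A x x.
Proof. by move=> Ax; apply/joined_inP; exists (cst x); split => // t; exact: cvg_cst. Qed.

Lemma joined_in_sym A x y : joined_in A x y -> joined_in A y x.
Proof.
move=> /joined_inP[f [cf f0 f1 Af]]; apply/joined_inP.
exists (fun t => f (1 - t)); split => //; last 2 first.
- by rewrite subr0.
- by rewrite subrr.
move=> t; have c1 : {for t, continuous (fun t : R => 1 - t)}.
  by apply: cvgB; [exact: cvg_cst|exact: cvg_id].
exact: (continuous_comp c1 (cf _)).
Qed.

Lemma joined_in_trans A y x z : joined_in A x y -> joined_in A y z -> joined_in A x z.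
Proof.
move=> [f [+ f0 f1 Af]] [g [+ g0 g1 Ag]].
have clip0 t : t <= 0 -> clip t = 0.
  by move=> t0; rewrite /clip min_l ?(le_trans t0)// max_l.
have clip1 t : 1 <= t -> clip t = 1.
  by move=> t1; rewrite /clip min_r// max_r ?ler01.
have ac (a b : R) : continuous (fun t : R => a * t + b).
  by move=> t; apply: cvgD; [apply: cvgM; [exact: cvg_cst|exact: cvg_id]|exact: cvg_cst].
move=> cf cg; apply/joined_inP.
(* For every [t] one of the two terms equals [y], so this sum runs through [f] and then [g], and its
   continuity needs no pasting at [t = 1/2]. *)
exists (fun t => f (clip (2 * t + 0)) + g (clip (2 * t + -1)) - y); split.
- move=> t; apply: cvgB; last exact: cvg_cst.
  by apply: cvgD; 
    [exact: (clip_comp_continuous cf (ac _ _))|exact: (clip_comp_continuous cg (ac _ _))].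
- by rewrite !clip0 ?f0 ?g0; [rewrite addrK|lra|lra].
- by rewrite !clip1 ?f1 ?g1; [rewrite addrAC subrr add0r|lra|lra].
- move=> t; case: (lerP t (2^-1)) => t2.
    by rewrite [clip (_ + -1)]clip0 ?g0 ?addrK; [exact: Af|lra].
  by rewrite [clip (_ + 0)]clip1 ?f1 1?addrAC ?subrr ?add0r; [exact: Ag|lra].
Qed.

Lemma joined_in_sub A V x y : A `<=` V -> joined_in A x y -> joined_in V x y.
Proof. by move=> AV [f [cf f0 f1 Af]]; exists f; split=> // t /Af/AV. Qed.

Lemma joined_in_end A x y : joined_in A x y -> A y.
Proof. by move=> [f [_ _ <- ]]; apply; rewrite in_itv/= lexx ler01. Qed.

Lemma joined_in_curve A (f : R -> 'rV[R]_n) : {within `[0, 1], continuous f} ->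
  (forall t, 0 <= t <= 1 -> A (f t)) -> joined_in A (f 0) (f 1).
Proof.
by move=> cf Af; exists f; split=> // t; rewrite in_itv/=; exact: Af.
Qed.

Lemma joined_in_segment A x y :
  (forall t, 0 <= t <= 1 -> A (x + t *: (y - x))) -> joined_in A x y.
Proof.
move=> Axy.
have cf : continuous (fun t : R => x + t *: (y - x)).
  move=> t; apply: cvgD; first exact: cvg_cst.
  by apply: cvgZl; exact: cvg_id.
have := @joined_in_curve A _ (continuous_subspaceT cf) Axy.
by rewrite scale0r addr0 scale1r addrC subrK.
Qed.

Definition path_component A x := [set w | joined_in A x w].

Lemma near_joined_in V w : open V -> V w -> \forall q \near w, joined_in V w q.
Proof.
rewrite openE => /[apply]; rewrite /interior/= => /nbhs_normP[e/= e0 eV].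
apply/nbhs_normP; exists e => //= q; rewrite /ball_/= => wq.
apply: joined_in_segment => t /andP[t0 t1]; apply: eV; rewrite /ball_/=.
rewrite opprD addrA subrr sub0r normrN normrZ ger0_norm// distrC.
by rewrite (le_lt_trans _ wq)// ler_piMl.
Qed.

Lemma path_component_open V x : open V -> open (path_component V x).
Proof.
move=> oV; rewrite openE => w xw; rewrite /interior/=.
apply: filterS (near_joined_in oV (joined_in_end xw)) => q.
exact: joined_in_trans.
Qed.

Lemma path_component_closed V x w : open V -> V w ->
  closure (path_component V x) w -> path_component V x w.
Proof.
move=> oV Vw cw; have [q [xq wq]] := cw _ (near_joined_in oV Vw).
by apply: (joined_in_trans xq); exact: joined_in_sym.
Qed.

(* If no point of the component had [f = a], its part where [f < a] would be
   open and closed in [Om]. *)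
Lemma path_component_crossing (Om : set 'rV[R]_n) (f : 'rV[R]_n -> R) (a b : R) x y :
  open Om -> connected Om -> continuous f -> f x < a -> a < b -> Om x -> Om y ->
  path_component (Om `&` [set w | f w < b]) x y \/
  exists2 w, path_component (Om `&` [set w | f w < b]) x w & f w = a.
Proof.
move=> oO cO cf xa ab Ox Oy.
set V := Om `&` _.
have oflt c : open [set w | f w < c] by apply: open_comp (@open_lt _ c) => w _; exact: cf.
have oV : open V by exact: openI.
have [|/forallNP na] := pselect (exists w, path_component V x w /\ f w = a).
  by move=> [w [? ?]]; right; exists w.
left; pose P := path_component V x `&` [set w | f w < a].
suff PO : P = Om by move: Oy; rewrite -PO => -[].
have oP : open P by apply: openI => //; exact: path_component_open.
have PsubO : P `<=` Om by move=> w [/joined_in_end[]].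
apply: cO.
- by exists x; split=> //; apply: joined_in_refl; split=> //=; exact: lt_trans ab.
- by exists P => //; rewrite setIidr.
- exists (closure P); first exact: closed_closure.
  apply/seteqP; split=> [w Pw|w [Ow cPw]]; first by split; [exact: PsubO|exact: subset_closure].
  have fwa : f w <= a.
    have cl : closed [set w | f w <= a].
      by apply: closed_comp (@closed_le _ a) => u _; exact: cf.
    by apply: cl; apply: closureS cPw => u [_ /ltW].
  have pw : path_component V x w.
    apply: path_component_closed => //; first by split=> //=; exact: le_lt_trans ab.
    by apply: closureS cPw => u [].
  split=> //=; rewrite lt_neqAle fwa andbT; apply/eqP => fw.
  exact: (na w).
Qed.

End paths.

(** * Euclidean geometry *)

Section euclidean.
Variables (R : realType) (n : nat).
Implicit Types (x y z w q : 'rV[R]_n).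

Definition dot x y : R := \sum_(i < n) x 0 i * y 0 i.

Lemma dotC x y : dot x y = dot y x.
Proof. by apply: eq_bigr => i _; rewrite mulrC. Qed.

Lemma dotDl x y z : dot (x + y) z = dot x z + dot y z.
Proof. by rewrite -big_split; apply: eq_bigr => i _; rewrite mxE mulrDl. Qed.

Lemma dotZl (a : R) x y : dot (a *: x) y = a * dot x y.
Proof. by rewrite mulr_sumr; apply: eq_bigr => i _; rewrite mxE mulrA. Qed.

Lemma dotDr x y z : dot z (x + y) = dot z x + dot z y.
Proof. by rewrite dotC dotDl !(dotC z). Qed.

Lemma dotZr (a : R) x y : dot x (a *: y) = a * dot x y.
Proof. by rewrite dotC dotZl dotC. Qed.

Lemma dotNl x y : dot (- x) y = - dot x y.
Proof. by rewrite -scaleN1r dotZl mulN1r. Qed.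

Lemma dotNr x y : dot x (- y) = - dot x y.
Proof. by rewrite dotC dotNl dotC. Qed.

Lemma dot_ge0 x : 0 <= dot x x.
Proof. by apply: sumr_ge0 => i _; rewrite -expr2 sqr_ge0. Qed.

Lemma dot_eq0 x : dot x x = 0 -> x = 0.
Proof.
move=> /eqP; rewrite psumr_eq0; last by move=> i _; rewrite -expr2 sqr_ge0.
move=> /allP h; apply/rowP => i; rewrite mxE.
by have := h i (mem_index_enum _); rewrite -expr2 sqrf_eq0 => /eqP.
Qed.

Lemma cauchy_schwarz x y : dot x y ^+ 2 <= dot x x * dot y y.
Proof.
have [y0|yn0] := eqVneq (dot y y) 0.
  rewrite (dot_eq0 y0) -(scale0r y) !dotZr !mul0r ?mulr0 expr2 mul0r lexx.
  by [].
have yp : 0 < dot y y by rewrite lt_neqAle eq_sym yn0 dot_ge0.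
have := dot_ge0 (dot y y *: x - dot x y *: y).
rewrite !(dotDl, dotDr, dotNl, dotNr, dotZl, dotZr) (dotC y x) => h.
have {h} : 0 <= dot y y * (dot x x * dot y y - dot x y ^+ 2) by apply: le_trans h _; lra.
by rewrite pmulr_rge0// subr_ge0.
Qed.

Definition nrm x : R := Num.sqrt (dot x x).

Lemma eucl_distE x y : eucl_dist x y = nrm (x - y).
Proof.
by rewrite /eucl_dist /nrm; congr Num.sqrt; apply: eq_bigr => i _; rewrite !mxE expr2.
Qed.

Lemma nrm_ge0 x : 0 <= nrm x. Proof. exact: sqrtr_ge0. Qed.

Lemma nrm_sqr x : nrm x ^+ 2 = dot x x.
Proof. by rewrite sqr_sqrtr// dot_ge0. Qed.

Lemma nrmZ (a : R) x : nrm (a *: x) = `|a| * nrm x.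
Proof. by rewrite /nrm dotZl dotZr mulrA -expr2 sqrtrM ?sqr_ge0// sqrtr_sqr. Qed.

Lemma nrmN x : nrm (- x) = nrm x.
Proof. by rewrite -scaleN1r nrmZ normrN1 mul1r. Qed.

Lemma nrm_eq0 x : nrm x = 0 -> x = 0.
Proof. by move=> x0; apply: dot_eq0; rewrite -nrm_sqr x0 expr0n. Qed.

Lemma nrm0 : nrm 0 = 0.
Proof. by rewrite -(scale0r 0) nrmZ normr0 mul0r. Qed.

Lemma dot_le_nrm x y : dot x y <= nrm x * nrm y.
Proof.
rewrite (le_trans (ler_norm _))// -ler_sqr ?nnegrE ?mulr_ge0 ?nrm_ge0//.
by rewrite exprMn !nrm_sqr real_normK ?num_real// cauchy_schwarz.
Qed.

Lemma nrmD x y : nrm (x + y) <= nrm x + nrm y.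
Proof.
rewrite -ler_sqr ?nnegrE ?addr_ge0 ?nrm_ge0//.
rewrite sqrrD !nrm_sqr dotDl !dotDr (dotC y x).
have := dot_le_nrm x y; lra.
Qed.

Lemma nrmB_le x y : `|nrm x - nrm y| <= nrm (x - y).
Proof.
have := nrmD (x - y) y; have := nrmD (y - x) x; rewrite !subrK -(nrmN (y - x)) opprB.
by rewrite ler_norml => h1 h2; apply/andP; split; lra.
Qed.

Lemma coord_le_nrm x i : `|x 0 i| <= nrm x.
Proof.
rewrite -ler_sqr ?nnegrE ?nrm_ge0// real_normK ?num_real// nrm_sqr.
rewrite /dot (bigD1 i)//= -expr2 lerDl.
by apply: sumr_ge0 => j _; rewrite -expr2 sqr_ge0.
Qed.

Lemma coord_le_norm x i : `|x 0 i| <= `|x|.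
Proof.
rewrite [leRHS]mx_normrE.
exact: (@le_bigmax _ R _ 0 (fun ij : 'I_1 * 'I_n => `|x ij.1 ij.2|) (0, i)).
Qed.

Lemma norm_lt_coord x (e : R) : 0 < e -> (forall i, `|x 0 i| < e) -> `|x| < e.
Proof.
move=> e0 xe; rewrite [ltLHS]mx_normrE; apply: bigmax_lt => // -[i j] _ /=.
by rewrite ord1.
Qed.

(** Links the Euclidean distance to the sup norm of the topology. The crude factor [n], instead of
    its square root, is the source of the factors [n] in the later constants. *)
Lemma nrm_le_norm x : nrm x <= n%:R * `|x|.
Proof.
rewrite -ler_sqr ?nnegrE ?nrm_ge0 ?mulr_ge0//.
rewrite nrm_sqr exprMn -natrX.
apply: (@le_trans _ _ (\sum_(i < n) `|x| ^+ 2)).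
  apply: ler_sum => i _; rewrite -expr2 -real_normK ?num_real// ler_sqr ?nnegrE//.
  exact: coord_le_norm.
rewrite sumr_const card_ord -[leLHS]mulr_natl ler_wpM2r ?sqr_ge0// ler_nat.
by rewrite -{1}(expn1 n); case: (n) => // m; rewrite leq_pexp2l.
Qed.

Lemma nrm_continuous z : continuous (fun w => nrm (w - z)).
Proof.
move=> w; apply/(@cvgrPdist_lt _ _ _ _ (nbhs_filter w)) => /= e e0.
have en0 : 0 < e / n.+1%:R by rewrite divr_gt0.
apply: filterS (nbhsx_ballx w _ en0) => q.
rewrite -ball_normE/= ltr_pdivlMr// => wq.
rewrite (le_lt_trans (nrmB_le _ _))// opprB addrA subrK.
rewrite (le_lt_trans (nrm_le_norm _))// (le_lt_trans _ wq)// mulrC.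
by rewrite ler_wpM2l// ler_nat.
Qed.

Lemma nrm_segment_lt x y (r t : R) : nrm x < r -> nrm y < r -> 0 <= t <= 1 ->
  nrm (x + t *: (y - x)) < r.
Proof.
move=> xr yr /andP[t0 t1].
have -> : x + t *: (y - x) = (1 - t) *: x + t *: y.
  by apply/rowP => i; rewrite !mxE; ring.
rewrite (le_lt_trans (nrmD _ _))// !nrmZ !ger0_norm ?subr_ge0//.
have [->|tn0] := eqVneq t 0; first by rewrite mul0r addr0 subr0 mul1r.
have {tn0}t0 : 0 < t by rewrite lt_neqAle eq_sym tn0.
have h1 : (1 - t) * nrm x <= (1 - t) * r by rewrite ler_wpM2l ?subr_ge0// ltW.
have h2 : t * nrm y < t * r by rewrite ltr_pM2l.
by lra.
Qed.

(** A segment from [w] leaving [Omega] would, by connectedness of [[0, 1]], meet the boundary at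
    distance at most [d] from [w]. This is how the restriction in [Dball] is exploited. *)
Lemma ball_subset_of_dist_boundary (Omega : set 'rV[R]_n) w q (d : R) :
  open Omega -> Omega w -> 0 <= d ->
  (d%:E < (2^-1)%:E * dist_boundary Omega w)%E -> nrm (q - w) <= d -> Omega q.
Proof.
move=> oO Ow d0 dw qw; apply: contrapT => nOq.
pose g (t : R) := w + t *: (q - w).
have cg : continuous g.
  by move=> t; apply: cvgD; [exact: cvg_cst|apply: cvgZl; exact: cvg_id].
pose I : set R := `[0, 1]%classic.
pose B := I `&` (g @^-1` Omega).
have B0 : B 0 by split; rewrite /I/= ?in_itv/= ?lexx ?ler01// /g scale0r addr0.
have BI : B = I.
  apply: (@segment_connected R 0 1) => //; first by exists 0.
    by exists (g @^-1` Omega) => //; apply: open_comp => // t _; exact: cg.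
  exists (g @^-1` closure Omega).
    by apply: closed_comp => [t _|]; [exact: cg|exact: closed_closure].
  apply/seteqP; split=> [t [It Ot]|t [It cOt]]; split=> //; first exact: subset_closure.
  apply: contrapT => nOt.
  have bt : (closure Omega `\` interior Omega) (g t).
    by split=> //; rewrite (interior_id _).1.
  have : (dist_boundary Omega w <= (eucl_dist w (g t))%:E)%E.
    by apply: ereal_inf_lbound; exists (g t).
  have tqw : eucl_dist w (g t) <= d.
    move: It; rewrite /I/= in_itv/= => /andP[t0 t1].
    rewrite eucl_distE /g opprD addrA subrr sub0r nrmN nrmZ ger0_norm//.
    by rewrite (le_trans _ qw)// ler_piMl// nrm_ge0.
  move=> dbt; have := le_lt_trans _ dw.
  move: dw; rewrite lte_pdivlMl//.
  move=> /lt_le_trans/(_ dbt); rewrite -EFinM lte_fin => h.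
  by have := sqrtr_ge0 (\sum_(i < n) (w 0 i - g t 0 i) ^+ 2); rewrite -/(eucl_dist _ _); lra.
have : B 1 by rewrite BI /I/= in_itv/= lexx ler01.
by move=> [_]; rewrite /= /g scale1r addrC subrK.
Qed.

End euclidean.

(** * Arcs that avoid a ball *)

Section arcs.
Variables (R : realType) (n : nat).
Implicit Types (x y z w q e f : 'rV[R]_n).

Lemma exists_unit_orthogonal e : (2 <= n)%N -> exists f, dot f e = 0 /\ dot f f = 1.
Proof.
move=> n2; pose i := Ordinal (ltnW n2); pose j := Ordinal n2.
have dotd k y : dot (delta_mx 0 k) y = y 0 k.
  rewrite /dot (bigD1 k)//= mxE !eqxx mul1r big1 ?addr0// => l lk.
  by rewrite mxE eqxx (negbTE lk) mul0r.
(* A quarter turn of the first two coordinates of [e]; if both vanish, [delta_mx 0 i] is already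
   orthogonal to [e]. *)
pose f0 := e 0 j *: delta_mx 0 i - e 0 i *: delta_mx 0 j : 'rV[R]_n.
have ij : (i == j) = false by [].
have f0e : dot f0 e = 0 by rewrite dotDl dotNl !dotZl !dotd mulrC subrr.
have [f00|f0n0] := eqVneq (dot f0 f0) 0; last first.
  exists ((nrm f0)^-1 *: f0); rewrite dotZl f0e mulr0 dotZl dotZr mulrA -nrm_sqr.
  have : nrm f0 != 0 by apply: contra f0n0 => /eqP/nrm_eq0 ->; rewrite -nrm_sqr nrm0 expr0n.
  by move=> h; split=> //; field.
exists (delta_mx 0 i); rewrite !dotd mxE !eqxx; split=> //.
have /matrixP/(_ 0 j) := dot_eq0 f00.
by rewrite !mxE !eqxx eq_sym ij/= mulr0 mulr1 sub0r => /eqP; rewrite oppr_eq0 => /eqP.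
Qed.

(* A radial segment followed by an arc of the sphere around [z] through [w'];
   along the arc the distance to [w] increases with the angle. *)
Lemma joined_in_ball_minus_ball z w w' (rho : R) : (2 <= n)%N -> 0 <= rho ->
  rho < nrm (w - z) -> rho < nrm (w' - z) ->
  joined_in [set q | nrm (q - w) <= nrm (w' - w) /\ rho < nrm (q - z)] w w'.
Proof.
move=> n2 rho0 tw tw'.
set A := [set q | _].
set x := w - z in tw *; set x' := w' - z in tw' *.
have wE : w = z + x by rewrite /x addrC subrK.
have w'E : w' = z + x' by rewrite /x' addrC subrK.
have xx' : w' - w = x' - x by rewrite /x /x' opprB addrA subrK.
clearbody x x'.
set t := nrm x in tw *; set t' := nrm x' in tw' *.
have t0 : 0 < t by exact: le_lt_trans tw.
have t'0 : 0 < t' by exact: le_lt_trans tw'.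
pose e := t^-1 *: x; pose c0 := dot x' e / t'.
have xE : x = t *: e by rewrite /e scalerA divff ?scale1r// gt_eqF.
have ee : dot e e = 1.
  by rewrite /e dotZl dotZr mulrA -nrm_sqr -/t; field; rewrite gt_eqF.
have ne : nrm e = 1 by rewrite /nrm ee sqrtr1.
clearbody e.
have x'e : dot x' e = t' * c0 by rewrite /c0; field; rewrite gt_eqF.
pose y := x' - (t' * c0) *: e.
have ye : dot y e = 0 by rewrite dotDl dotNl dotZl ee x'e mulr1 subrr.
have yy : dot y y = t' ^+ 2 * (1 - c0 ^+ 2).
  rewrite /y !(dotDl, dotDr, dotNl, dotNr, dotZl, dotZr) (dotC e) x'e ee -nrm_sqr -/t'.
  by ring.
have c01 : 0 <= 1 - c0 ^+ 2.
  by have := dot_ge0 y; rewrite yy pmulr_rge0// exprn_gt0.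
have c0N1 : -1 <= c0 <= 1.
  by rewrite -ler_norml -ler_sqr ?nnegrE ?ler01// real_normK ?num_real// expr1n; lra.
(* When [z], [w] and [w'] are collinear, the part [y] of [x'] orthogonal to [e] vanishes and the
   plane of the arc is arbitrary; a normal direction exists because [2 <= n]. *)
have [f [fe ff yf]] : exists f, [/\ dot f e = 0, dot f f = 1 & nrm y *: f = y].
  have [y0|yn0] := eqVneq y 0.
    have [f [? ?]] := exists_unit_orthogonal e n2; exists f.
    by rewrite y0 nrm0 scale0r.
  have ny : nrm y != 0 by apply: contra yn0 => /eqP/nrm_eq0 ->.
  exists ((nrm y)^-1 *: y); rewrite dotZl ye mulr0 dotZl dotZr mulrA -nrm_sqr.
  by rewrite scalerA divff// scale1r; split=> //; field.
have ny : nrm y = t' * Num.sqrt (1 - c0 ^+ 2).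
  by rewrite /nrm yy sqrtrM ?sqr_ge0// sqrtr_sqr gtr0_norm.
have dn : `|t' - t| <= nrm (w' - w) by rewrite xx'; exact: nrmB_le.
apply: (@joined_in_trans _ _ _ (z + t' *: e)).
  apply: joined_in_segment => s /andP[s0 s1].
  have -> : w + s *: (z + t' *: e - w) = w + (s * (t' - t)) *: e.
    rewrite wE xE.
    by apply/rowP => i; rewrite !mxE; ring.
  rewrite /A/=; split.
    rewrite addrC addKr nrmZ ne mulr1 normrM ger0_norm//.
    by rewrite (le_trans _ dn)// ler_piMl.
  have -> : w + (s * (t' - t)) *: e - z = (t + s * (t' - t)) *: e.
    by rewrite wE xE addrAC (addrC z) addrK -scalerDl.
  rewrite nrmZ ne mulr1 (lt_le_trans _ (ler_norm _))//.
  have [tt'|tt'] := lerP t t'; first by rewrite (lt_le_trans tw)// lerDl mulr_ge0// subr_ge0.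
  rewrite (lt_le_trans tw')//; have : s * (t - t') <= t - t' by rewrite ler_piMl// subr_ge0 ltW.
  by lra.
(* The arc is parametrised by the cosine of the angle with [e], moving linearly from 1 to [c0], so
   no trigonometric function is involved. *)
pose c s : R := 1 - s * (1 - c0).
pose g s := z + t' *: (c s *: e + Num.sqrt (1 - c s ^+ 2) *: f).
have g0 : g 0 = z + t' *: e.
  by rewrite /g /c mul0r subr0 expr1n subrr sqrtr0 scale0r addr0 scale1r.
have g1 : g 1 = w'.
  have c1 : c 1 = c0 by rewrite /c; ring.
  rewrite /g c1 scalerDr !scalerA -ny yf /y.
  by rewrite w'E (addrC ((t' * c0) *: e)) subrK.
rewrite -g0 -g1; apply: joined_in_curve.
  apply: continuous_subspaceT => s.
  have cc : c u @[u --> s] --> c s.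
    by apply: cvgB; [exact: cvg_cst|apply: cvgMl; exact: cvg_id].
  apply: cvgD; first exact: cvg_cst.
  apply: cvgZr; apply: cvgD; apply: cvgZl => //.
  have c2 : {for s, continuous (fun u => 1 - c u ^+ 2)}.
    by apply: cvgB; [exact: cvg_cst|rewrite !expr2; apply: cvgM].
  exact: (continuous_comp c2 (@sqrt_continuous _ _)).
move=> s /andP[s0 s1].
have cs : c0 <= c s <= 1.
  rewrite /c; have : 0 <= s * (1 - c0) by rewrite mulr_ge0//; lra.
  have : s * (1 - c0) <= 1 - c0 by rewrite ler_piMl//; lra.
  by lra.
have cs2 : 0 <= 1 - c s ^+ 2.
  by have -> : 1 - c s ^+ 2 = (1 - c s) * (1 + c s) by [ring]; apply: mulr_ge0; lra.
pose p := g s - z.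
have pE : p = t' *: (c s *: e + Num.sqrt (1 - c s ^+ 2) *: f) by rewrite /p /g addrC addKr.
have pp : dot p p = t' ^+ 2.
  rewrite pE !(dotDl, dotDr, dotNl, dotNr, dotZl, dotZr) (dotC e f) fe ee ff.
  transitivity (t' ^+ 2 * (c s ^+ 2 + Num.sqrt (1 - c s ^+ 2) ^+ 2)); first by ring.
  by rewrite sqr_sqrtr//; ring.
have pe : dot p e = t' * c s.
  by rewrite pE !(dotDl, dotDr, dotNl, dotNr, dotZl, dotZr) fe ee; ring.
rewrite /A/=; split; last by rewrite -/p /nrm pp sqrtr_sqr gtr0_norm.
(* The squared distance to [w] is [t' ^ 2 - 2 t t' c s + t ^ 2], which decreases in [c s], and
   [c s >= c0]. *)
have -> : g s - w = p - x by rewrite /p wE opprD addrA.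
clearbody p.
rewrite xx' /nrm ler_sqrt ?dot_ge0//.
rewrite !(dotDl, dotDr, dotNl, dotNr) (dotC x p) (dotC x x') pp.
rewrite -(nrm_sqr x') -/t' xE !(dotZl, dotZr) pe x'e.
have : t * t' * c0 <= t * t' * c s by case/andP: cs => cs _; rewrite ler_wpM2l// ltW// mulr_gt0.
lra.
Qed.

End arcs.

(** * Lebesgue measure *)

Section lebesgue_outer_boxes.
Variables (R : realType) (n : nat).
Hypothesis n0 : (0 < n)%N.
Local Notation corners := ('rV[R]_n * 'rV[R]_n)%type.
Implicit Types (c : corners) (x : 'rV[R]_n) (i : 'I_n) (A B : set 'rV[R]_n).

Lemma box_volume00 : box_volume (0 : 'rV[R]_n, 0 : 'rV[R]_n) = 0.
Proof.
rewrite /box_volume (bigD1 (Ordinal n0))//= !mxE subrr maxxx mul0r.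
by [].
Qed.

(** Sums over [nat] can be split and integrated term by term, unlike the sums over sets of boxes in
    [lebesgue_outer]. *)
Lemma countable_cover_seq (C : set corners) : countable C ->
  exists c : nat -> corners,
    \bigcup_(d in C) box d `<=` \bigcup_k box (c k) /\
    (\sum_(k <oo) (box_volume (c k))%:E <= \esum_(d in C) (box_volume d)%:E)%E.
Proof.
move=> /countable_injP[f finj].
pose P k d := C d /\ f d = k.
(* Indices outside the image of [f] receive the degenerate box, whose volume is 0 because
   [0 < n]. *)
pose c k : corners := xget (0, 0) (P k).
have cf d : C d -> c (f d) = d.
  move=> Cd; rewrite /c; case: xgetP => [y -> [Cy fy]|/(_ d)]; last by case.
  by apply: finj; rewrite ?inE.
exists c; split.
  by move=> x [d Cd dx]; exists (f d) => //; rewrite cf.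
rewrite nneseries_esumT; last by move=> k; exact: box_volume_ge0.
rewrite -(@eq_esum _ _ C (fun d => (box_volume (c (f d)))%:E)); last by move=> d /cf ->.
rewrite -(@esum_image _ _ _ C f (fun k => (box_volume (c k))%:E))//.
rewrite [leRHS]esum_mkcond; apply: le_esum => k _.
case: ifPn => [//|kC]; rewrite /c; case: xgetP => [y _ [Cy fy]|_]; last by rewrite box_volume00.
by exfalso; move/negP: kC; apply; rewrite inE; exists y.
Qed.

Lemma lebesgue_outer_box_le c : (lebesgue_outer (box c) <= (box_volume c)%:E)%E.
Proof.
apply: ereal_inf_lbound; exists [set c].
  by split; [exact: countable1|move=> x cx; exists c].
by rewrite esum_set1// box_volume_ge0.
Qed.

Lemma lebesgue_outer_seq_le A (c : nat -> corners) : A `<=` \bigcup_k box (c k) ->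
  (lebesgue_outer A <= \sum_(k <oo) (box_volume (c k))%:E)%E.
Proof.
move=> Ac; apply: (le_trans (le_lebesgue_outer Ac)).
apply: (le_trans (lebesgue_outer_sigma_subadditive _)).
by apply: lee_nneseries => k _; [move=> _; exact: lebesgue_outer_ge0|exact: lebesgue_outer_box_le].
Qed.

Definition upd x i (a : R) : 'rV[R]_n := \row_j if j == i then a else x 0 j.

Lemma updE x i a j : upd x i a 0 j = if j == i then a else x 0 j.
Proof. by rewrite mxE. Qed.

(** The [min] here and the [max] in [box_high] make a cut outside the [i]-th side yield the box
    itself and a piece of volume 0. *)
Definition box_low c i t : corners := (c.1, upd c.2 i (Num.min (c.2 0 i) t)).
Definition box_high c i t : corners := (upd c.1 i (Num.max (c.1 0 i) t), c.2).

Lemma box_lowE c i t : box c `&` [set x | x 0 i <= t] `<=` box (box_low c i t).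
Proof.
move=> x [cx /= xt] j; have := cx j; rewrite !in_itv/= updE.
by case: eqP => [->|//] /andP[-> ?] /=; rewrite le_min xt andbT.
Qed.

Lemma box_highE c i t : box c `&` ~` [set x | x 0 i <= t] `<=` box (box_high c i t).
Proof.
move=> x [cx /= /negP]; rewrite -ltNge => xt j; have := cx j; rewrite !in_itv/= updE.
by case: eqP => [->|//] /andP[? ->] /=; rewrite gt_max xt !andbT.
Qed.

Lemma box_volume_split c i t :
  box_volume (box_low c i t) + box_volume (box_high c i t) = box_volume c.
Proof.
have E d : box_volume d = Num.max 0 (d.2 0 i - d.1 0 i) *
    \prod_(j < n | j != i) Num.max 0 (d.2 0 j - d.1 0 j).
  by rewrite /box_volume (bigD1 i).
rewrite !E /= !updE eqxx.
rewrite (eq_bigr (fun j => Num.max 0 (c.2 0 j - c.1 0 j))); last first.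
  by move=> j /negbTE ji; rewrite updE ji.
rewrite [X in _ + _ * X](eq_bigr (fun j => Num.max 0 (c.2 0 j - c.1 0 j))); last first.
  by move=> j /negbTE ji; rewrite updE ji.
rewrite -mulrDl; congr (_ * _).
case: (lerP (c.2 0 i) t) => h1; case: (lerP (c.1 0 i) t) => h2;
  repeat (case: lerP => ?); lra.
Qed.

(** The hyperplane cuts every box of a cover into two boxes whose volumes add up exactly, so a cover
    of [X] splits into covers of both parts at no extra cost. *)
Lemma halfspace_caratheodory i (t : R) :
  caratheodory_measurable (@lebesgue_outer R n) [set x | x 0 i <= t].
Proof.
apply: le_caratheodory_measurable => X.
apply: le_ereal_inf_tmp => _ [C [cC XC] <-].
have [c [Cc cle]] := countable_cover_seq cC; apply: le_trans cle.
have Xc := subset_trans XC Cc.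
rewrite -(eq_eseriesr (fun k _ => congr1 EFin (box_volume_split (c k) i t))).
under eq_eseriesr do rewrite EFinD.
rewrite nneseriesD; [|by move=> *; exact: box_volume_ge0|by move=> *; exact: box_volume_ge0].
apply: leeD; apply: lebesgue_outer_seq_le => x [/Xc[k _ ckx] xt]; exists k => //.
  exact: box_lowE.
exact: box_highE.
Qed.

Let side c i := Num.max 0 (c.2 0 i - c.1 0 i).

(* Integrating in the coordinates of [x] one after the other, from [k = 0] to
   [k = n], turns covers by boxes into inequalities between volumes. *)
Let partial_volume k c x : R := \prod_(i < n)
  if (i < k)%N then side c i else \1_(`]c.1 0 i, c.2 0 i] : set R) (x 0 i).

Let partial_volume_ge0 k c x : 0 <= partial_volume k c x.
Proof. by apply: prodr_ge0 => i _; case: ifP => // _; rewrite le_max lexx. Qed.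

Lemma box_volume_le_cover (d0 : corners) (c : nat -> corners) : box d0 `<=` \bigcup_k box (c k) ->
  ((box_volume d0)%:E <= \sum_(k <oo) (box_volume (c k))%:E)%E.
Proof.
move=> dc.
suff H k : (k <= n)%N -> forall x, ((partial_volume k d0 x)%:E <=
    \sum_(j <oo) (partial_volume k (c j) x)%:E)%E.
  have := H n (leqnn n) 0.
  have E d : partial_volume n d 0 = box_volume d.
    by apply: eq_bigr => i _; rewrite ltn_ord.
  by rewrite E; under eq_eseriesr do rewrite E.
elim: k => [_ x|k IH kn x].
  have E d : partial_volume 0 d x = \1_(box d) x.
    rewrite /partial_volume indicE; case: (boolP (x \in box d)) => [|] xd.
      rewrite big1// => i _; rewrite indicE mem_set//.
      by move: xd; rewrite inE => /(_ i).
    have [i xi] : exists i, ~ x 0 i \in `]d.1 0 i, d.2 0 i].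
      by apply/existsNP => h; move/negP: xd; apply; rewrite inE.
    rewrite (bigD1 i)//= indicE memNset ?mul0r//.
  rewrite E indicE; case: (boolP (x \in box d0)) => [|_]; last first.
    by apply: nneseries_ge0 => j _ _; rewrite lee_fin.
  rewrite inE => /dc[j _ cjx].
  rewrite nneseries_esumT; last by move=> l; rewrite lee_fin.
  apply: esum_ge; exists [set j]; first by split; [exact: finite_set1|].
  by rewrite fsbig_set1 E indicE mem_set.
pose i0 := Ordinal kn.
pose W c := \prod_(i < n | i != i0)
  if (i < k)%N then side c i else \1_(`]c.1 0 i, c.2 0 i] : set R) (x 0 i).
have W0 d : 0 <= W d.
  by apply: prodr_ge0 => i _; case: ifP => // _; rewrite le_max lexx.
have E1 d : partial_volume k.+1 d x = W d * side d i0.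
  rewrite /partial_volume (bigD1 i0)//= ltnSn mulrC; congr (_ * _).
  apply: eq_bigr => i ii0; rewrite ltnS leq_eqVlt.
  have -> // : (i == k :> nat) = false.
  by apply: contraNF ii0 => /eqP ik; apply/eqP/val_inj.
have E2 d t : partial_volume k d (upd x i0 t) = W d * \1_(`]d.1 0 i0, d.2 0 i0] : set R) t.
  rewrite /partial_volume (bigD1 i0)//= ltnn updE eqxx mulrC; congr (_ * _).
  by apply: eq_bigr => i /negbTE ii0; rewrite updE ii0.
(* One-dimensional integration in the coordinate [i0] turns its indicator into a side length, so
   integrating the induction hypothesis gives the next stage. *)
have I d : (\int[lebesgue_measure]_(t in setT) (partial_volume k d (upd x i0 t))%:E)%E =
    (partial_volume k.+1 d x)%:E.
  under eq_integral do rewrite E2 EFinM.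
  rewrite ge0_integralZl_EFin//; last first.
    by apply/measurable_EFinP; exact: measurable_indic.
  rewrite integral_indic// setIT E1 EFinM; congr (_ * _)%E.
  apply: (etrans (lebesgue_measure_itv `]d.1 0 i0, d.2 0 i0])).
  rewrite /= lte_fin /side; case: ltP => h.
    by rewrite -EFinD max_r// subr_ge0 ltW.
  by rewrite max_l// subr_le0.
have mE d : measurable_fun setT (fun t => (partial_volume k d (upd x i0 t))%:E).
  apply/measurable_EFinP; under eq_fun do rewrite E2.
  by apply: measurable_funM; [exact: measurable_cst|exact: measurable_indic].
rewrite -I; under eq_eseriesr do rewrite -I.
rewrite -integral_nneseries//; last by move=> j t _; rewrite lee_fin.
apply: ge0_le_integral => //.
- by move=> t _; rewrite lee_fin.
- exact: mE.
- have h j t : setT t -> xpredT j -> (0 <= (partial_volume k (c j) (upd x i0 t))%:E)%E.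
    by rewrite lee_fin.
  exact: (ge0_emeasurable_sum h (fun j _ => mE (c j))).
- by move=> t _; apply: IH; exact: ltnW.
- by move=> j; exact: mE.
Qed.

Lemma lebesgue_outer_box c : lebesgue_outer (box c) = (box_volume c)%:E.
Proof.
apply/eqP; rewrite eq_le lebesgue_outer_box_le/=.
apply: le_ereal_inf_tmp => _ [C [cC XC] <-].
have [d [Cd dle]] := countable_cover_seq cC; apply: le_trans dle.
by apply: box_volume_le_cover; exact: subset_trans Cd.
Qed.

End lebesgue_outer_boxes.

(** * Measurable sets and measures of balls *)

Section lebesgue_measurability.
Variables (R : realType) (n : nat).
Hypothesis n0 : (0 < n)%N.
Implicit Types (x z w : 'rV[R]_n) (i : 'I_n).
Local Notation mu := (@lebesgue_measureRn R n).

Lemma measurable_coord i : measurable_fun setT (fun x : lebesgueRn R n => (x : 'rV[R]_n) 0 i).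
Proof.
apply: (measurability _ (RGenOInfty.measurableE R)) => _ [_ [t ->] <-].
rewrite setTI.
have -> : (fun x : lebesgueRn R n => (x : 'rV[R]_n) 0 i) @^-1` `]t, +oo[ =
    ~` [set x : 'rV[R]_n | x 0 i <= t].
  by apply/seteqP; split=> x /=; rewrite in_itv/= andbT ltNge => /negP.
by apply: measurableC; exact: halfspace_caratheodory.
Qed.

(** An open set is the countable union of the rational cubes [Q p] inside it, and each cube is a
    finite intersection of measurable coordinate strips. *)
Lemma measurable_open (U : set 'rV[R]_n) : open U -> measurable (U : set (lebesgueRn R n)).
Proof.
move=> oU.
pose Q (p : 'rV[rat]_n * nat) : set 'rV[R]_n :=
  \bigcap_(i in [set: 'I_n]) [set x | `|x 0 i - ratr (p.1 0 i)| < p.2.+1%:R^-1].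
have -> : U = \bigcup_(p in [set p | Q p `<=` U]) Q p.
  apply/seteqP; split; last by move=> x [p /= + ]; apply.
  move=> x Ux; move: (oU); rewrite openE => /(_ _ Ux); rewrite /interior/=.
  move=> /nbhs_normP[e /= e0 eU].
  pose k := Num.truncn (2 / e).
  have ke : 2 / k.+1%:R < e.
    by rewrite ltr_pdivrMr// mulrC -ltr_pdivrMr// truncnS_gt.
  have [q qx] : {q : 'I_n -> rat & forall i, `|x 0 i - ratr (q i)| < k.+1%:R^-1}.
    apply: (@choice _ _ (fun i (q : rat) => `|x 0 i - ratr q| < k.+1%:R^-1)) => i.
    have xk : x 0 i - k.+1%:R^-1 < x 0 i + k.+1%:R^-1.
      by rewrite ltrBlDr -addrA ltrDl addr_gt0.
    have [q] := rat_in_itvoo xk.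
    by rewrite in_itv/= => /andP[q1 q2]; exists q; rewrite ltr_distlC q1.
  exists (\row_i q i, k); last by move=> i _ /=; rewrite mxE.
  move=> y Qy; apply: eU; rewrite /ball_/=; apply: norm_lt_coord => // i.
  apply: lt_trans ke; have := Qy i I; have := qx i; rewrite /= !mxE => h1 h2.
  have -> : x 0 i - y 0 i = (x 0 i - ratr (q i)) - (y 0 i - ratr (q i)) by ring.
  by rewrite (le_lt_trans (ler_normB _ _))// mulr_natl mulr2n ltrD.
rewrite bigcup_mkcond; apply: countable_bigcupT_measurable => [|p]; first exact: countableP.
case: ifPn => // _.
rewrite /Q; apply: fin_bigcap_measurable; first exact: finite_finset.
move=> i _.
rewrite [X in measurable X](_ : _ = (fun x : lebesgueRn R n => (x : 'rV[R]_n) 0 i) @^-1`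
    `]ratr (p.1 0 i) - p.2.+1%:R^-1, ratr (p.1 0 i) + p.2.+1%:R^-1[).
  by rewrite -[X in measurable X]setTI; exact: measurable_coord.
by apply/seteqP; split=> x /=; rewrite in_itv/= ltr_distl.
Qed.

Lemma continuous_measurableRn (f : 'rV[R]_n -> R) : continuous f ->
  measurable_fun setT (f : lebesgueRn R n -> R).
Proof.
move=> cf; apply: (measurability _ (RGenOpens.measurableE R)) => _ [_ [a [b ->]] <-].
rewrite setTI; apply: measurable_open.
by apply: open_comp => [x _|]; [exact: cf|exact: itv_open].
Qed.

Lemma lebesgue_ball_ge x (rho : R) : 0 < rho -> ((rho ^+ n)%:E <= mu (ball x rho))%E.
Proof.
move=> rho0.
(* Half the size of the sup-norm ball, so that the closed faces of the box stay inside the open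
   ball. *)
pose c : 'rV[R]_n * 'rV[R]_n := (\row_i (x 0 i - rho / 2), \row_i (x 0 i + rho / 2)).
have -> : rho ^+ n = box_volume c.
  rewrite /box_volume -[in LHS](card_ord n) -prodr_const; apply: eq_bigr => i _.
  by rewrite !mxE max_r; lra.
rewrite -lebesgue_outer_box//; apply: le_lebesgue_outer => y cy.
rewrite -ball_normE/=; apply: norm_lt_coord => // i.
have := cy i; rewrite in_itv/= !mxE => /andP[? ?]; rewrite ltr_norml; apply/andP; split; lra.
Qed.

Lemma lebesgue_nrm_ball_le z (rho : R) : 0 < rho ->
  (mu [set x | (nrm (x - z) < rho)%R] <= ((2 * rho) ^+ n)%:E)%E.
Proof.
move=> rho0.
pose c : 'rV[R]_n * 'rV[R]_n := (\row_i (z 0 i - rho), \row_i (z 0 i + rho)).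
have -> : (2 * rho) ^+ n = box_volume c.
  rewrite /box_volume -[in LHS](card_ord n) -prodr_const; apply: eq_bigr => i _.
  by rewrite !mxE max_r; lra.
rewrite -lebesgue_outer_box//; apply: le_lebesgue_outer => y /= cy i.
have := le_lt_trans (coord_le_nrm (y - z) i) cy.
rewrite in_itv/= !mxE ltr_norml => /andP[? ?]; apply/andP; split; lra.
Qed.

(** The exceptional set in [Dball] is not assumed measurable; completeness of the Caratheodory
    measure supplies this. *)
Lemma lebesgue_null_measurable (N : set 'rV[R]_n) : mu N = 0%E ->
  measurable (N : set (lebesgueRn R n)).
Proof.
move=> N0; apply: le_caratheodory_measurable => X.
have XN0 : (lebesgue_outer (X `&` N) <= 0)%E.
  by rewrite -N0; apply: le_lebesgue_outer; exact: subIsetr.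
rewrite -[leRHS]add0e; apply: leeD => //.
by apply: le_lebesgue_outer; exact: subIsetl.
Qed.

End lebesgue_measurability.

(** * Lower bound for the energy *)

(** Of the two halves of []c - h, c + h[], keep one with the smaller [F]: its half-length would be
    [h / 2] if measured as a diameter, hence [h / 4] as a radius. The centre moves by [h / 4], and
    these moves sum to [h / 3], so the limit [t] keeps a margin [2h / 3] inside every interval. The
    clause for [k = 0] locates [t] near [c0]. *)
Lemma bisection (R : realType) (F : R -> R -> R) (c0 h0 : R) : 0 < h0 ->
  (forall c h, 0 < h -> F (c - h / 4) (h / 4) + F (c + h / 4) (h / 4) <= F c h) ->
  exists t, forall k, exists c,
    `|t - c| <= h0 / 4 ^+ k / 3 /\ F c (h0 / 4 ^+ k) <= F c0 h0 / 2 ^+ k /\ (k = 0 -> c = c0).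
Proof.
move=> h00 Fsup.
pose h k : R := h0 / 4 ^+ k.
have hp k : 0 < h k by rewrite divr_gt0// exprn_gt0.
have hS k : h k.+1 = h k / 4 by rewrite /h exprS; field; rewrite expf_neq0.
pose step k c := if F (c - h k / 4) (h k / 4) <= F (c + h k / 4) (h k / 4)
  then c - h k / 4 else c + h k / 4.
pose c := fix c k := if k is j.+1 then step j (c j) else c0.
have cF k : F (c k) (h k) <= F c0 h0 / 2 ^+ k.
  elim: k => [|k IH]; first by rewrite /h !expr0 !divr1.
  rewrite hS exprS invfM mulrCA /= /step.
  by have := Fsup (c k) (h k) (hp k); case: ifPn => [|/negbTE]; case: leP => //; lra.
have cS k : c k.+1 = c k - h k / 4 \/ c k.+1 = c k + h k / 4.
  by rewrite /= /step; case: ifP; [left|right].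
(* The intervals of radius [h k / 3] around [c k] are nested; [t] is the supremum of their left
   ends. *)
have low k j : c k - h k / 3 <= c (k + j)%N - h (k + j)%N / 3.
  elim: j => [|j IH]; first by rewrite addn0.
  apply: le_trans IH _; rewrite addnS hS.
  by have := hp (k + j)%N; case: (cS (k + j)%N) => ->; lra.
have high k j : c (k + j)%N + h (k + j)%N / 3 <= c k + h k / 3.
  elim: j => [|j IH]; first by rewrite addn0.
  apply: le_trans IH; rewrite addnS hS.
  by have := hp (k + j)%N; case: (cS (k + j)%N) => ->; lra.
have lowhigh k j : c k - h k / 3 <= c j + h j / 3.
  have [kj|jk] := leqP k j.
    have := low k (j - k)%N; rewrite subnKC// => /le_trans; apply.
    by have := hp j; lra.
  have := high j (k - j)%N; rewrite subnKC ?(ltnW jk)//; apply: le_trans.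
  by have := hp k; lra.
pose L := [set c k - h k / 3 | k in [set: nat]].
have Lub k : ubound L (c k + h k / 3) by move=> _ [j _ <-].
have L0 : L !=set0 by exists (c 0 - h 0 / 3), 0.
exists (sup L) => k; exists (c k); split; last by split=> [|->]; [exact: cF|].
rewrite ler_distl; apply/andP; split.
  by apply: ub_le_sup; [exists (c k + h k / 3)|exists k].
by apply: ge_sup.
Qed.

Section good_points.
Variables (R : realType) (n : nat) (s : R).
Hypotheses (n0 : (0 < n)%N) (s0 : 0 < s).
Local Notation mu := (@lebesgue_measureRn R n).
Local Notation p := (n%:R / s).

(** Chebyshev's inequality: if [g] exceeded the bound almost everywhere on the ball, its energy
    there would be at least [kappa ^ p * rho ^ -n * rho ^ n], since [s * p = n]. *)
Lemma exists_good_point (g : 'rV[R]_n -> R) (N : set 'rV[R]_n) (w : 'rV[R]_n) (rho kappa : R) :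
  0 < rho -> 0 < kappa -> (forall x, 0 <= g x) ->
  measurable_fun setT (g : lebesgueRn R n -> R) -> mu N = 0%E ->
  (\int[mu]_(x in (ball w rho : set (lebesgueRn R n))) (g x `^ p)%:E < (kappa `^ p)%:E)%E ->
  exists a, [/\ ball w rho a, ~ N a & g a <= kappa * rho `^ (- s)].
Proof.
move=> rho0 k0 g0 mg N0 small; apply: contrapT => noa.
have big a : ball w rho a -> ~ N a -> kappa * rho `^ (- s) < g a.
  by move=> wa Na; rewrite ltNge; apply/negP => ga; apply: noa; exists a.
have p0 : 0 < p by rewrite divr_gt0// ltr0n.
have mN := lebesgue_null_measurable N0.
have mB : measurable (ball w rho : set (lebesgueRn R n)).
  by apply: measurable_open => //; exact: ball_open.
have mBN : measurable ((ball w rho `\` N) : set (lebesgueRn R n)) by exact: measurableD.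
have mgp : measurable_fun setT (fun x : lebesgueRn R n => (g x `^ p)%:E).
  by apply/measurable_EFinP; apply: (measurableT_comp (measurable_powR _) mg).
have BN : (mu (ball w rho) <= mu (ball w rho `\` N))%E.
  rewrite -[leRHS]adde0 -N0 -measureU//; last by rewrite setDE -setIA setICl setI0.
  apply: le_measure; rewrite ?inE//; first by exact: measurableU.
  by move=> x wx; have [Nx|Nx] := pselect (N x); [right|left].
pose m := kappa `^ p * rho `^ (- n%:R).
have mE : (kappa * rho `^ (- s)) `^ p = m.
  rewrite powRM ?powR_ge0 ?(ltW k0)// -powRrM; congr (_ * _ `^ _).
  by rewrite mulNr mulrCA divff ?mulr1// gt_eqF.
have : ((kappa `^ p)%:E <=
    \int[mu]_(x in (ball w rho : set (lebesgueRn R n))) (g x `^ p)%:E)%E; last first.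
  by move=> /(lt_le_trans small); rewrite ltxx.
apply: (@le_trans _ _ (\int[mu]_(x in ((ball w rho `\` N) : set (lebesgueRn R n)))
    (g x `^ p)%:E)%E); last first.
  apply: ge0_subset_integral => //; first exact: measurable_funTS.
  by move=> x _; rewrite lee_fin powR_ge0.
apply: (@le_trans _ _ (\int[mu]_(x in ((ball w rho `\` N) : set (lebesgueRn R n)))
    (cst m%:E x))%E); last first.
  apply: ge0_le_integral => //.
  - by move=> x _; rewrite lee_fin mulr_ge0 ?powR_ge0.
  - exact: measurable_funTS.
  - move=> x [wx Nx]; rewrite lee_fin -mE ge0_ler_powR ?nnegrE ?(ltW p0)//.
      by rewrite mulr_ge0 ?powR_ge0 ?(ltW k0).
    by rewrite ltW// big.
rewrite integral_cst//.
apply: (@le_trans _ _ (m%:E * (rho ^+ n)%:E)%E); last first.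
  rewrite lee_pmul// ?lee_fin ?mulr_ge0 ?powR_ge0 ?exprn_ge0 ?(ltW rho0)//.
  by apply: le_trans BN; exact: lebesgue_ball_ge.
rewrite -EFinM lee_fin /m -mulrA -powR_mulrn ?(ltW rho0)// -powRD ?addNr ?powRr0 ?mulr1//.
by rewrite (gt_eqF rho0) implybT.
Qed.

(** In each step [r k ^ s] from the distance cancels [r k ^ -s] from the gradient, leaving
    [10 n kappa q ^ k], which is summed as a geometric series. The hypothesis [s <= 1] bounds
    [(2 n) ^ s] and [4 ^ s] by their bases. *)
Lemma good_point_chain (u g : 'rV[R]_n -> R) (N : set 'rV[R]_n) (w : 'rV[R]_n)
    (l rho kappa q : R) :
  s <= 1 -> 0 < rho -> 0 < kappa -> 0 < q < 1 -> (forall x, 0 <= g x) ->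
  (forall x y, ~ N x -> ~ N y -> `|u x - u y| <= nrm (x - y) `^ s * (g x + g y)) ->
  (\forall x \near w, u x = l) ->
  (forall k, exists a, [/\ ball w (rho / 4 ^+ k) a, ~ N a &
     g a <= kappa * q ^+ k * (rho / 4 ^+ k) `^ (- s)]) ->
  exists a, [/\ ball w rho a, ~ N a, g a <= kappa * rho `^ (- s) &
    `|u a - l| <= 10 * n%:R * kappa / (1 - q)].
Proof.
move=> s1 rho0 k0 /andP[q0 q1] g0 uN ul /choice[a ha].
pose r k := rho / 4 ^+ k.
have r0 k : 0 < r k by rewrite divr_gt0// exprn_gt0.
have rS k : r k = 4 * r k.+1 by rewrite /r exprS; field; rewrite expf_neq0.
have n1 : 1 <= n%:R :> R by rewrite ler1n.
have step k : `|u (a k) - u (a k.+1)| <= 10 * n%:R * kappa * q ^+ k.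
  have [bk Nk gk] := ha k; have [bk1 Nk1 gk1] := ha k.+1.
  rewrite -/(r k) -/(r k.+1) in bk gk bk1 gk1.
  apply: (le_trans (uN _ _ Nk Nk1)).
  have d : nrm (a k - a k.+1) <= 2 * n%:R * r k.
    apply: (le_trans (nrm_le_norm _)).
    rewrite [leRHS](_ : _ = n%:R * (2 * r k)); last by ring.
    rewrite ler_wpM2l//.
    have := bk; have := bk1; rewrite -!ball_normE/= => h1 h2.
    have -> : a k - a k.+1 = (w - a k.+1) - (w - a k) by rewrite opprB [RHS]addrC addrA subrK.
    have := rS k; have := r0 k.+1.
    by have := ler_normB (w - a k.+1) (w - a k); lra.
  have ds : nrm (a k - a k.+1) `^ s <= 2 * n%:R * r k `^ s.
    apply: (@le_trans _ _ ((2 * n%:R * r k) `^ s)).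
      have c0 : 0 <= 2 * n%:R * r k by rewrite !mulr_ge0// ltW.
      by rewrite ge0_ler_powR ?nnegrE ?nrm_ge0 ?(ltW s0).
    have n2 : 0 <= 2 * n%:R :> R by rewrite mulr_ge0.
    rewrite (powRM _ n2 (ltW (r0 k))).
    rewrite ler_wpM2r ?powR_ge0//.
    by rewrite -[leRHS]powRr1 ?mulr_ge0// ler_powR//; lra.
  have rs : r k.+1 `^ (- s) <= 4 * r k `^ (- s).
    rewrite (rS k) powRM ?(ltW (r0 _))// mulrA -[leLHS]mul1r ler_wpM2r ?powR_ge0//.
    rewrite powRN -ler_pdivrMr ?invr_gt0 ?powR_gt0// invrK mul1r.
    by rewrite -[leRHS]powRr1// ler_powR//; lra.
  have rr : r k `^ s * r k `^ (- s) = 1.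
    by rewrite powRN divff// gt_eqF// powR_gt0.
  have qk : 0 < q ^+ k by rewrite exprn_gt0.
  have gg : g (a k) + g (a k.+1) <= 5 * kappa * q ^+ k * r k `^ (- s).
    have : kappa * q ^+ k.+1 * r k.+1 `^ (- s) <= kappa * q ^+ k * (4 * r k `^ (- s)).
      apply: ler_pM => //; rewrite ?powR_ge0 ?mulr_ge0 ?exprn_ge0 ?(ltW k0) ?(ltW q0)//.
      by rewrite ler_pM2l// exprS ler_piMl// ltW.
    by lra.
  apply: (@le_trans _ _ (2 * n%:R * r k `^ s * (5 * kappa * q ^+ k * r k `^ (- s)))).
    by apply: ler_pM; rewrite ?powR_ge0 ?addr_ge0.
  rewrite [leLHS](_ : _ = 10 * n%:R * kappa * q ^+ k * (r k `^ s * r k `^ (- s))); last by ring.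
  by rewrite rr mulr1.
set C := 10 * n%:R * kappa in step *.
have C0 : 0 <= C by rewrite /C !mulr_ge0 ?(ltW k0).
have sum K : `|u (a 0) - u (a K)| <= C / (1 - q) * (1 - q ^+ K).
  elim: K => [|K IH]; first by rewrite !subrr normr0 mulr0.
  rewrite (le_trans (ler_distD (u (a K)) _ _))//.
  apply: (le_trans (lerD IH (step K))).
  by rewrite exprS le_eqVlt; apply/orP; left; apply/eqP; field; lra.
have [a0 Na0 ga0] := ha 0; rewrite expr0 divr1 mulr1 in a0 ga0.
exists (a 0); split=> //.
have [e/= e0 eu] := (nbhs_ballP _ _).1 ul.
(* At this depth the ball lies where [u] is constantly [l], so the telescoping is finite and [u] is
   never evaluated at [w]. *)
pose K := Num.truncn (rho / e).
have re : r K.+1 < e.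
  rewrite /r ltr_pdivrMr ?exprn_gt0// mulrC -ltr_pdivrMr//.
  apply: (lt_le_trans (truncnS_gt _)); rewrite -natrX ler_nat.
  by rewrite ltnW// ltn_expl.
have [bK _ _] := ha K.+1.
have <- : u (a K.+1) = l by apply: eu; exact: le_ball (ltW re) _ bK.
apply: (le_trans (sum _)); rewrite ler_piMr ?divr_ge0//; first by lra.
by rewrite gerBl exprn_ge0// ltW.
Qed.

End good_points.

Section loewner.
Variables (R : realType) (n : nat) (s : R).
Hypotheses (n0 : (0 < n)%N) (s0 : 0 < s) (s1 : s <= 1).
Local Notation mu := (@lebesgue_measureRn R n).
Local Notation p := (n%:R / s).

(* Pushing [g ^ p] forward under the distance to [z], a bisection gives a radius
   [t] around which annuli of width [4 ^ - k] carry mass at most [2 ^ - k]; the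
   chains of balls shrinking to the two points at distance [t] lie in these
   annuli. *)
Lemma loewner_lower_bound : exists2 K : R, 0 < K &
  forall (z : 'rV[R]_n) (h kappa : R) (u g : 'rV[R]_n -> R) (N : set 'rV[R]_n),
  0 < h -> 0 < kappa -> (forall x, 0 <= g x) ->
  measurable_fun setT (g : lebesgueRn R n -> R) -> mu N = 0%E ->
  (forall x y, ~ N x -> ~ N y -> `|u x - u y| <= nrm (x - y) `^ s * (g x + g y)) ->
  (forall t, 2 * h < t < 4 * h ->
    exists2 w, nrm (w - z) = t & \forall x \near w, u x = 1) ->
  (forall t, 2 * h < t < 4 * h ->
    exists2 w, nrm (w - z) = t & \forall x \near w, u x = 0) ->
  (\int[mu]_x (g x `^ p)%:E < (kappa `^ p)%:E)%E -> 1 <= kappa * K.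
Proof.
(* Chosen so that [q ^ p = 1/2]: energy halving at each scale becomes decay of the gradient bound by
   [q]. *)
pose q : R := 2^-1 `^ (p^-1).
have p0 : 0 < p by rewrite divr_gt0// ltr0n.
have q0 : 0 < q by rewrite powR_gt0.
have qp : q `^ p = 2^-1 by rewrite -powRrM mulVf ?gt_eqF// powRr1.
have q1 : q < 1.
  by rewrite ltNge; apply/negP => q1; have := @ge0_ler_powR R p (ltW p0) 1 q;
  rewrite !nnegrE ler01 (ltW q0) => /(_ isT isT q1); rewrite powR1 qp; lra.
have n1 : 1 <= n%:R :> R by rewrite ler1n.
(* Two chains contribute [10 n / (1 - q)] each; comparing their starting points contributes
   [36 n]. *)
exists (20 * n%:R / (1 - q) + 36 * n%:R).
  by rewrite addr_gt0 ?divr_gt0 ?mulr_gt0//; lra.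
move=> z h kappa u g N h0 k0 g0 mg N0 uN u1 u0 small.
pose A c h' := [set x : 'rV[R]_n | `|nrm (x - z) - c| < h'].
have mA c h' : measurable (A c h' : set (lebesgueRn R n)).
  apply: measurable_open => //.
  have -> : A c h' = (fun x => nrm (x - z)) @^-1` `]c - h', c + h'[.
    by apply/seteqP; split=> x; rewrite /A/= in_itv/= ltr_distl.
  by apply: open_comp => [x _|]; [exact: nrm_continuous|exact: itv_open].
have mgp : measurable_fun setT (fun x : lebesgueRn R n => (g x `^ p)%:E).
  by apply/measurable_EFinP; apply: (measurableT_comp (measurable_powR _) mg).
have gp0 (D : set (lebesgueRn R n)) (x : lebesgueRn R n) : D x -> (0 <= (g x `^ p)%:E)%E.
  by rewrite lee_fin powR_ge0.
pose I (D : set 'rV[R]_n) := (\int[mu]_(x in (D : set (lebesgueRn R n))) (g x `^ p)%:E)%E.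
have Ile (D E : set 'rV[R]_n) : measurable (D : set (lebesgueRn R n)) ->
    measurable (E : set (lebesgueRn R n)) -> D `<=` E -> (I D <= I E)%E.
  by move=> mD mE DE; apply: ge0_subset_integral => //; [exact: measurable_funTS|exact: gp0].
have Ifin c h' : I (A c h') \is a fin_num.
  rewrite ge0_fin_numE; last by apply: integral_ge0; exact: gp0.
  by apply: (le_lt_trans (Ile _ setT _ _ _)) => //; apply: (lt_trans small); exact: ltry.
pose F c h' := fine (I (A c h')).
have Fsup c h' : 0 < h' -> F (c - h' / 4) (h' / 4) + F (c + h' / 4) (h' / 4) <= F c h'.
  move=> h'0; rewrite -lee_fin EFinD /F !fineK//.
  rewrite /I -ge0_integral_setU//; last 3 first.
  - exact: measurable_funTS.
  - exact: gp0.
  - apply/disj_setPS => x [] /=; rewrite /A/= !ltr_norml => /andP[? ?] /andP[? ?]; lra.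
  apply: Ile => //; first exact: measurableU.
  by move=> x [] /=; rewrite /A/= !ltr_norml => /andP[? ?]; apply/andP; split; lra.
have [t ht] := @bisection R F (3 * h) h h0 Fsup.
have thh : 2 * h < t < 4 * h.
  have [c [tc [_ /(_ erefl) cE]]] := ht 0; move: tc; rewrite cE.
  by rewrite expr0 divr1 ler_norml => /andP[? ?]; apply/andP; split; lra.
have small0 : F (3 * h) h < kappa `^ p.
  by rewrite -lte_fin /F fineK//; apply: le_lt_trans small; exact: Ile.
(* A sup-norm ball of radius [rho / 4 ^ k] then has Euclidean radius at most [h / 4 ^ k / 2]; with
   the offset [h / 4 ^ k / 3] from the bisection it still fits in the annulus, as
   [1/2 + 1/3 < 1]. *)
pose rho := h / (2 * n%:R).
have rho0 : 0 < rho by rewrite divr_gt0//; lra.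
have nrho : n%:R * rho = h / 2 by rewrite /rho; field; rewrite gt_eqF//; lra.
have good w : nrm (w - z) = t -> forall k, exists a, [/\ ball w (rho / 4 ^+ k) a, ~ N a &
     g a <= kappa * q ^+ k * (rho / 4 ^+ k) `^ (- s)].
  move=> wt k; apply: exists_good_point => //.
  - by rewrite divr_gt0// exprn_gt0.
  - by rewrite mulr_gt0// exprn_gt0.
  have [c [tc [Fc _]]] := ht k.
  have hk : 0 < h / 4 ^+ k by rewrite divr_gt0// exprn_gt0.
  apply: (@le_lt_trans _ _ (I (A c (h / 4 ^+ k)))).
    apply: Ile => //; first by apply: measurable_open => //; exact: ball_open.
    move=> x; rewrite -ball_normE/= distrC => wx; rewrite /A/=.
    have -> : nrm (x - z) - c = (nrm (x - z) - nrm (w - z)) + (t - c).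
      by rewrite wt addrA subrK.
    have h1 : `|nrm (x - z) - nrm (w - z)| <= h / 4 ^+ k / 2.
      apply: (le_trans (nrmB_le _ _)); rewrite opprB addrA subrK.
      apply: (le_trans (nrm_le_norm _)).
      apply: (@le_trans _ _ (n%:R * (rho / 4 ^+ k))); first by rewrite ler_wpM2l// ltW.
      by rewrite mulrA nrho mulrAC.
    by rewrite (le_lt_trans (ler_normD _ _))//; lra.
  rewrite -(fineK (Ifin _ _)) lte_fin.
  apply: (le_lt_trans Fc).
  rewrite powRM ?exprn_ge0 ?(ltW k0) ?(ltW q0)// ltr_pdivrMr ?exprn_gt0//.
  have -> : (q ^+ k) `^ p = (2^-1) ^+ k.
    by rewrite -(powR_mulrn k (ltW q0)) -powRrM mulrC powRrM qp powR_mulrn.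
  by rewrite -mulrA -exprMn mulVf// expr1n mulr1.
have q01 : 0 < q < 1 by apply/andP.
have [w wt w1] := u1 t thh; have [w' w't w'0] := u0 t thh.
have [a [wa Na ga ua]] := good_point_chain n0 s0 s1 rho0 k0 q01 g0 uN w1 (good w wt).
have [b [wb Nb gb ub]] := good_point_chain n0 s0 s1 rho0 k0 q01 g0 uN w'0 (good w' w't).
have far v x : nrm (v - z) = t -> ball v rho x -> nrm (x - z) <= h / 2 + 4 * h.
  rewrite -ball_normE/= distrC => vt vx.
  have -> : x - z = (x - v) + (v - z) by rewrite addrA subrK.
  apply: (le_trans (nrmD _ _)); rewrite vt; apply: lerD; last by case/andP: thh => _ /ltW.
  by apply: (le_trans (nrm_le_norm _)); rewrite -nrho ler_wpM2l// ltW.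
(* Both points are within [9 h / 2] of [z], and [9 h = 18 n rho]. *)
have ab : nrm (a - b) <= 18 * n%:R * rho.
  have -> : a - b = (a - z) - (b - z) by rewrite opprB addrA subrK.
  apply: (le_trans (nrmD _ _)); rewrite nrmN -mulrA nrho.
  by have := far _ _ wt wa; have := far _ _ w't wb; lra.
have uab : `|u a - u b| <= 36 * n%:R * kappa.
  apply: (le_trans (uN _ _ Na Nb)).
  have abs : nrm (a - b) `^ s <= 18 * n%:R * rho `^ s.
    apply: (@le_trans _ _ ((18 * n%:R * rho) `^ s)).
      have c0 : 0 <= 18 * n%:R * rho by rewrite !mulr_ge0// ltW.
      by rewrite ge0_ler_powR ?nnegrE ?nrm_ge0 ?(ltW s0).
    have n18 : 0 <= 18 * n%:R :> R by rewrite mulr_ge0.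
    rewrite (powRM _ n18 (ltW rho0)).
    rewrite ler_wpM2r ?powR_ge0//.
    by rewrite -[leRHS]powRr1 ?mulr_ge0// ler_powR//; lra.
  have rr : rho `^ s * rho `^ (- s) = 1 by rewrite powRN divff// gt_eqF// powR_gt0.
  apply: (@le_trans _ _ (18 * n%:R * rho `^ s * (2 * kappa * rho `^ (- s)))).
    by apply: ler_pM; rewrite ?powR_ge0 ?addr_ge0//; lra.
  rewrite [leLHS](_ : _ = 36 * n%:R * kappa * (rho `^ s * rho `^ (- s))); last by ring.
  by rewrite rr mulr1.
have tri : 1 <= `|u a - 1| + `|u a - u b| + `|u b - 0|.
  have := ler_normB (u a - u b + (u b - 0)) (u a - 1); have := ler_normD (u a - u b) (u b - 0).
  have -> : u a - u b + (u b - 0) - (u a - 1) = 1 by ring.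
  by rewrite normr1; lra.
have -> : kappa * (20 * n%:R / (1 - q) + 36 * n%:R) =
    10 * n%:R * kappa / (1 - q) + 36 * n%:R * kappa + 10 * n%:R * kappa / (1 - q).
  by field; lra.
lra.
Qed.

End loewner.

(** * Energy of logarithmic cutoffs *)

(** With [x = (b - a) / a] this is [ln (1 + x) <= x ^ s / s]. For [x <= 1] use
    [ln (1 + x) <= x <= x ^ s]; for larger [x] use [ln (1 + x) <= ln 2 + ln x] with
    [s ln x <= x ^ s - 1]. It is the origin of the factor [s^-1] in the gradient. *)
Lemma ln_ratio_le (R : realType) (s a b : R) : 0 < s -> s <= 1 -> 0 < a -> a <= b ->
  ln (b / a) <= s^-1 * ((b - a) / a) `^ s.
Proof.
move=> s0 s1 a0 ab; set x := (b - a) / a.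
have x0 : 0 <= x by rewrite divr_ge0 ?subr_ge0// ltW.
have -> : b / a = 1 + x by rewrite /x; field; rewrite gt_eqF.
have si : 1 <= s^-1 by rewrite invf_ge1.
have [x1|x1] := lerP x 1.
  have xN1 : -1 < x by lra.
  apply: (le_trans (le_ln1Dx xN1)); apply: (@le_trans _ _ (x `^ s)).
    have [->|xn0] := eqVneq x 0; first by rewrite powR_ge0.
    by rewrite ger1_powR// x1 andbT lt_neqAle eq_sym xn0.
  by rewrite ler_peMl ?powR_ge0.
rewrite mulrC ler_pdivlMr//.
have xp : 0 < x by lra.
have h1 : ln (1 + x) <= ln (2 * x) by rewrite ler_ln ?posrE//; lra.
have h2 : ln (2 * x) = ln 2 + ln x by rewrite lnM ?posrE.
have h3 : ln (2 : R) <= 1 by have -> : (2 : R) = 1 + 1 by []; apply: le_ln1Dx; lra.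
have h4 : s * ln x <= x `^ s - 1.
  rewrite -ln_powR; have := @le_ln1Dx R (x `^ s - 1).
  by rewrite [1 + _]addrC subrK; apply; rewrite ltrBrDr addNr powR_gt0.
have : ln (1 + x) * s <= (ln 2 + ln x) * s by rewrite ler_wpM2r ?(ltW s0)// -h2.
have : ln 2 * s <= 1 * 1 by apply: ler_pM; rewrite ?(ltW s0)// ln_ge0//; lra.
lra.
Qed.

Section log_cutoff.
Variables (R : realType) (n : nat) (s : R) (N : nat) (z : 'rV[R]_n) (r : R).
Hypotheses (n0 : (0 < n)%N) (s0 : 0 < s) (s1 : s <= 1) (N0 : (0 < N)%N) (r0 : 0 < r).
Local Notation mu := (@lebesgue_measureRn R n).
Local Notation p := (n%:R / s).
Let r2 := 2 ^+ N * r.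
Let clip (t : R) := Num.min (Num.max t r) r2.

(** The scale-invariant profile: between [r] and [2 ^ N r], every doubling of the distance to [z]
    raises it by [1 / N]. *)
Definition log_cutoff (w : 'rV[R]_n) : R :=
  ln (Num.min (Num.max (nrm (w - z)) r) (2 ^+ N * r) / r) / (N%:R * ln 2).

Definition log_cutoff_gradient (w : 'rV[R]_n) : R :=
  (s * N%:R * ln 2)^-1 * Num.max (nrm (w - z)) r `^ (- s) *
  \1_[set w | nrm (w - z) < 2 ^+ N * r] w.

Let ln2 : 0 < ln (2 : R). Proof. by rewrite ln_gt0// ltr1n. Qed.

Let L0 : 0 < N%:R * ln 2 :> R. Proof. by rewrite mulr_gt0// ltr0n. Qed.

Let r12 : r <= r2. Proof. by rewrite /r2 ler_peMl ?(ltW r0)// exprn_ege1// ler1n. Qed.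

Let clip_itv t : r <= clip t <= r2.
Proof. by rewrite /clip le_min le_max lexx orbT r12/= ge_min lexx orbT. Qed.

Lemma log_cutoff_itv w : 0 <= log_cutoff w <= 1.
Proof.
have /andP[h1 h2] := clip_itv (nrm (w - z)).
rewrite /log_cutoff -/r2 -/(clip _); apply/andP; split.
  by apply: divr_ge0; [rewrite ln_ge0// ler_pdivlMr// mul1r|exact: ltW].
rewrite ler_pdivrMr// mul1r mulr_natl -lnXn// ler_ln ?posrE ?exprn_gt0//.
  by rewrite ler_pdivrMr.
by rewrite divr_gt0// (lt_le_trans r0).
Qed.

Lemma log_cutoff0 w : nrm (w - z) <= r -> log_cutoff w = 0.
Proof. by move=> wr; rewrite /log_cutoff max_r// min_l// divff ?gt_eqF// ln1 mul0r. Qed.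

Lemma log_cutoff1 w : 2 ^+ N * r <= nrm (w - z) -> log_cutoff w = 1.
Proof.
move=> wr; rewrite /log_cutoff max_l ?(le_trans r12)// min_r//.
rewrite mulfK ?gt_eqF//.
have -> : ln (2 ^+ N) = N%:R * ln 2 :> R by rewrite lnXn// mulr_natl.
by rewrite divff// gt_eqF.
Qed.

Lemma log_cutoff_measurable : measurable_fun setT (log_cutoff : lebesgueRn R n -> R).
Proof.
apply: measurable_funM; last exact: measurable_cst.
apply: (measurableT_comp (@measurable_ln R)).
apply: measurable_funM; last exact: measurable_cst.
apply: measurable_minr; last exact: measurable_cst.
apply: measurable_maxr; last exact: measurable_cst.
exact: (continuous_measurableRn n0 (@nrm_continuous _ _ z)).
Qed.

Lemma log_cutoff_gradient_ge0 w : 0 <= log_cutoff_gradient w.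
Proof.
rewrite /log_cutoff_gradient indicE.
by rewrite mulr_ge0 ?ler0n// mulr_ge0 ?powR_ge0// invr_ge0 -mulrA mulr_ge0 ?(ltW s0) ?(ltW L0).
Qed.

Let ball_measurable a : measurable ([set w | nrm (w - z) < a] : set (lebesgueRn R n)).
Proof.
apply: measurable_open => //; apply: open_comp (@open_lt _ a) => w _.
exact: nrm_continuous.
Qed.

Lemma log_cutoff_gradient_measurable :
  measurable_fun setT (log_cutoff_gradient : lebesgueRn R n -> R).
Proof.
apply: measurable_funM; last exact: measurable_indic.
apply: measurable_funM; first exact: measurable_cst.
apply: (measurableT_comp (@measurable_powR R (- s))).
apply: measurable_maxr; last exact: measurable_cst.
exact: (continuous_measurableRn n0 (@nrm_continuous _ _ z)).
Qed.

Lemma log_cutoff_le w w' : `|log_cutoff w - log_cutoff w'| <=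
  nrm (w - w') `^ s * (log_cutoff_gradient w + log_cutoff_gradient w').
Proof.
wlog ww' : w w' / nrm (w - z) <= nrm (w' - z).
  move=> H; have [|/ltW ww'] := lerP (nrm (w - z)) (nrm (w' - z)); first exact: H.
  by rewrite distrC (addrC (log_cutoff_gradient w)) -(nrmN (w - w')) opprB; exact: H.
have [tr2|tr2] := lerP r2 (nrm (w - z)).
  rewrite !log_cutoff1 ?(le_trans tr2)// subrr normr0.
  by rewrite mulr_ge0 ?powR_ge0// addr_ge0// log_cutoff_gradient_ge0.
(* The gradient at [w], the point nearer to [z], suffices, because [ln_ratio_le] divides by the
   smaller radius. *)
apply: (@le_trans _ _ (nrm (w - w') `^ s * log_cutoff_gradient w)); last first.
  by rewrite ler_wpM2l ?powR_ge0// lerDl log_cutoff_gradient_ge0.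
rewrite /log_cutoff_gradient indicE mem_set// mulr1.
pose a := Num.max (nrm (w - z)) r; pose b := clip (nrm (w' - z)).
have ca : clip (nrm (w - z)) = a by rewrite /clip min_l// ge_max (ltW tr2).
have a0 : 0 < a by rewrite lt_max r0 orbT.
have ab : a <= b.
  rewrite /b /clip le_min /a !ge_max (ltW tr2) r12 !le_max ww' lexx orbT.
  by [].
have bad : b - a <= nrm (w - w').
  apply: (@le_trans _ _ (nrm (w' - z) - nrm (w - z))); last first.
    apply: (le_trans (ler_norm _)); apply: (le_trans (nrmB_le _ _)).
    by rewrite opprB addrA subrK -nrmN opprB.
  have h1 : b <= Num.max (nrm (w' - z)) r by rewrite /b /clip ge_min lexx.
  by move: h1; rewrite /a; case: (lerP (nrm (w' - z)) r) => ?;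
    case: (lerP (nrm (w - z)) r) => ?; lra.
have E : log_cutoff w' - log_cutoff w = ln (b / a) / (N%:R * ln 2).
  rewrite /log_cutoff -/r2 -/(clip (nrm (w' - z))) -/(clip (nrm (w - z))) ca -/b -mulrBl.
  congr (_ / _).
  have b0 : 0 < b by exact: lt_le_trans ab.
  by rewrite !ln_div ?posrE//; ring.
rewrite distrC E ger0_norm; last first.
  by apply: divr_ge0; [rewrite ln_ge0// ler_pdivlMr// mul1r|exact: ltW].
apply: (@le_trans _ _ (s^-1 * ((b - a) / a) `^ s / (N%:R * ln 2))).
  by rewrite ler_wpM2r ?invr_ge0 ?(ltW L0)//; exact: ln_ratio_le.
rewrite powRM ?subr_ge0 ?invr_ge0 ?(ltW a0)// -(powR_inv1 (ltW a0)) -powRrM mulN1r.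
rewrite [leLHS](_ : _ = (b - a) `^ s * ((s * N%:R * ln 2)^-1 * a `^ (- s))); last first.
  by field; rewrite !gt_eqF// ltr0n.
rewrite ler_wpM2r ?mulr_ge0 ?powR_ge0//.
  by rewrite invr_ge0 -mulrA mulr_ge0// ltW.
by rewrite ge0_ler_powR ?nnegrE ?nrm_ge0 ?subr_ge0// ltW.
Qed.

(** Among the [N + 1] concentric balls of radii [2 ^ k r], the smallest one containing a point
    bounds the gradient there. Each ball contributes at most [4 ^ n] times the common factor, as
    [(r_k / 2) ^ -n] meets the measure bound [(2 r_k) ^ n]. *)
Lemma log_cutoff_energy : (\int[mu]_x (log_cutoff_gradient x `^ p)%:E <=
  ((s * N%:R * ln 2)^-1 `^ p * (4 ^+ n * N.+1%:R))%:E)%E.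
Proof.
have p0 : 0 < p by rewrite divr_gt0// ltr0n.
have c0 : 0 <= (s * N%:R * ln 2)^-1 by rewrite invr_ge0 -mulrA mulr_ge0// ltW.
pose rk k : R := 2 ^+ k * r.
have rk0 k : 0 < rk k by rewrite mulr_gt0// exprn_gt0.
pose f k (x : lebesgueRn R n) : \bar R := (((s * N%:R * ln 2)^-1 `^ p * (rk k / 2) ^- n)%:E *
  (\1_[set w | (nrm (w - z) < rk k)%R] x)%:E)%E.
have C0 k : 0 <= (s * N%:R * ln 2)^-1 `^ p * (rk k / 2) ^- n.
  by rewrite mulr_ge0 ?powR_ge0// invr_ge0 exprn_ge0// divr_ge0// ltW.
have f0 k x : (0 <= f k x)%E by rewrite mule_ge0// lee_fin.
have mf k : measurable_fun setT (f k).
  apply: emeasurable_funM; first exact: measurable_cst.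
  by apply/measurable_EFinP; exact: measurable_indic.
pose G (x : lebesgueRn R n) : \bar R := (\sum_(k <- iota 0 N.+1) f k x)%E.
apply: (@le_trans _ _ (\int[mu]_x G x)%E).
  apply: ge0_le_integral => //.
  - by move=> x _; rewrite lee_fin powR_ge0.
  - apply/measurable_EFinP; apply: (measurableT_comp (measurable_powR _)).
    exact: log_cutoff_gradient_measurable.
  - exact: emeasurable_sum.
  move=> x _.
  have [xr2|xr2] := ltrP (nrm (x - z)) r2; last first.
    rewrite /log_cutoff_gradient indicE memNset/= ?mulr0 ?powR0 ?gt_eqF//.
      by apply: sume_ge0 => k _.
    by apply/negP; rewrite -leNgt.
  have exk : exists k, nrm (x - z) < rk k by exists N.
  (* Minimality gives [max(|x - z|, r) >= r_k / 2]; for [k = 0] this comes from the term [r]. *)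
  have [k xk kmin] := ex_minnP exk.
  have kN : (k <= N)%N by exact: kmin.
  have kin : k \in iota 0 N.+1 by rewrite mem_iota.
  rewrite /G (bigD1_seq k kin (iota_uniq _ _)).
  apply: (@le_trans _ _ (f k x)); last by rewrite leeDl// sume_ge0.
  rewrite /f /log_cutoff_gradient !indicE !mem_set//= mulr1 mule1 lee_fin.
  rewrite powRM ?powR_ge0// ler_wpM2l ?powR_ge0//.
  have m0 : 0 < Num.max (nrm (x - z)) r by rewrite lt_max r0 orbT.
  rewrite -powRrM mulNr mulrCA divff ?gt_eqF// mulr1 powRN powR_mulrn ?(ltW m0)//.
  rewrite lef_pV2 ?posrE ?exprn_gt0 ?divr_gt0//.
  apply: lerXn2r; rewrite ?nnegrE ?(ltW m0) ?divr_ge0 ?(ltW (rk0 _))//.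
  rewrite le_max; case: k xk kmin {kin kN} => [|k] xk kmin.
    apply/orP; right; rewrite /rk expr0 mul1r ler_pdivrMr// ler_peMr ?(ltW r0)//.
    by rewrite ler1n.
  apply/orP; left; have -> : rk k.+1 / 2 = rk k by rewrite /rk exprS; field.
  by rewrite leNgt; apply/negP => /kmin; rewrite ltnn.
have -> : (\int[mu]_x G x)%E = (\sum_(k <- iota 0 N.+1) \int[mu]_x f k x)%E.
  by rewrite /G; exact: ge0_integral_sum.
apply: (@le_trans _ _ (\sum_(k <- iota 0 N.+1) ((s * N%:R * ln 2)^-1 `^ p * 4 ^+ n)%:E)%E).
  apply: lee_sum => k _; rewrite ge0_integralZl_EFin//; last first.
    by apply/measurable_EFinP; exact: measurable_indic.
  rewrite integral_indic// setIT.
  apply: (@le_trans _ _ (((s * N%:R * ln 2)^-1 `^ p * (rk k / 2) ^- n)%:E *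
        ((2 * rk k) ^+ n)%:E)%E).
    by apply: lee_pmul; rewrite ?lee_fin//; exact: lebesgue_nrm_ball_le.
  rewrite -EFinM lee_fin -[leLHS]mulrA ler_wpM2l ?powR_ge0//.
  rewrite -exprVn -exprMn le_eqVlt; apply/orP; left; apply/eqP; congr (_ ^+ _).
  by field; rewrite gt_eqF.
rewrite sumEFin big_const_seq count_predT size_iota iter_addr_0 mulrA.
by rewrite -[X in (X%:E <= _)%E]mulr_natr.
Qed.

End log_cutoff.

Lemma ltr_poweR (R : realType) (r : R) (x y : \bar R) :
  0 < r -> (0 <= x)%E -> (x < y)%E -> (x `^ r < y `^ r)%E.
Proof.
move=> r0 x0 xy; rewrite ltNge; apply/negP => yx.
have y0 : (0 <= y)%E by rewrite (le_trans x0)// ltW.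
have ri : (0 <= r^-1)%R by rewrite invr_ge0 ltW.
have := @gt0_ler_poweR R r^-1 ri (y `^ r)%E (x `^ r)%E.
rewrite !in_itv/= !poweR_ge0 !leey => /(_ isT isT yx).
by rewrite -!poweRrM divff ?gt_eqF// !poweRe1// leNgt xy.
Qed.

(** * Cutoffs of arbitrarily small norm *)

Section capacity.
Variables (R : realType) (n : nat) (s : R).
Hypotheses (n2 : (2 <= n)%N) (s0 : 0 < s) (s1 : s <= 1).
Local Notation mu := (@lebesgue_measureRn R n).
Local Notation p := (n%:R / s).

Let n0 : (0 < n)%N. Proof. exact: ltnW. Qed.

Let p0 : 0 < p. Proof. by rewrite divr_gt0// ltr0n. Qed.

(** Since [n >= 2] and [s <= 1] give [p >= 2], the factor [N ^ -p * (N + 1)] is at most [2 / N]. *)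
Lemma log_cutoff_energy_small (e : R) : 0 < e -> exists2 N, (0 < N)%N &
  (s * N%:R * ln 2)^-1 `^ p * (4 ^+ n * N.+1%:R) <= e.
Proof.
move=> e0.
have l2 : 0 < ln (2 : R) by rewrite ln_gt0// ltr1n.
have p2 : 2 <= p.
  by rewrite ler_pdivlMr// (@le_trans _ _ (2 * 1))// ?ler_wpM2l// mulr1 ler_nat.
pose C := 2 * 4 ^+ n * (s * ln 2)^-1 `^ p.
exists (Num.truncn (C / e)).+1 => //.
set N := (Num.truncn (C / e)).+1.
have N0 : 0 < N%:R :> R by rewrite ltr0n.
have CN : C / N%:R <= e.
  by rewrite ler_pdivrMr// mulrC -ler_pdivrMr// ltW// truncnS_gt.
apply: le_trans CN.
have -> : (s * N%:R * ln 2)^-1 = (s * ln 2)^-1 * N%:R^-1.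
  by field; rewrite !gt_eqF.
rewrite powRM ?invr_ge0 ?mulr_ge0 ?(ltW s0) ?(ltW l2)//.
have Np : N%:R^-1 `^ p <= N%:R^-1 * N%:R^-1 :> R.
  rewrite -expr2 -powR_mulrn ?invr_ge0//; apply: ger_powR => //.
  by rewrite invr_gt0 N0 invf_le1// ler1n.
have NS : N.+1%:R <= 2 * N%:R :> R.
  by rewrite -natrM ler_nat mul2n -addnn -addn1 leq_add2l.
have h : N%:R^-1 `^ p * N.+1%:R <= 2 / N%:R :> R.
  apply: (@le_trans _ _ (N%:R^-1 * N%:R^-1 * (2 * N%:R))).
    by apply: ler_pM; rewrite ?powR_ge0.
  by rewrite le_eqVlt; apply/orP; left; apply/eqP; field; rewrite gt_eqF.
rewrite [leLHS](_ : _ = 4 ^+ n * (s * ln 2)^-1 `^ p * (N%:R^-1 `^ p * N.+1%:R)); last by ring.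
rewrite [leRHS](_ : _ = 4 ^+ n * (s * ln 2)^-1 `^ p * (2 / N%:R)); last by rewrite /C; ring.
by rewrite ler_wpM2l// mulr_ge0 ?powR_ge0 ?exprn_ge0.
Qed.

Lemma Lp_norm_le (D : set 'rV[R]_n) (g : 'rV[R]_n -> R) (k : R) : open D ->
  0 <= k -> (forall x, 0 <= g x) -> measurable_fun setT (g : lebesgueRn R n -> R) ->
  (\int[mu]_x (g x `^ p)%:E <= (k `^ p)%:E)%E -> (Lp_norm p%:E D g <= k%:E)%E.
Proof.
move=> oD k0 g0 mg gk.
have mD : measurable (D : set (lebesgueRn R n)) by exact: measurable_open.
rewrite /Lp_norm leNgt; apply/negP => kL.
have : (((k `^ p)%:E) < Lnorm mu p%:E (EFin \o (g \_ D)) `^ p)%E.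
  by rewrite -poweR_EFin; apply: ltr_poweR.
rewrite powR_Lnorm ?gt_eqF// ltNge => /negP; apply; apply: le_trans gk.
have gD0 (x : lebesgueRn R n) : 0 <= (g \_ D) x.
  by rewrite patchE; case: ifP.
have -> : (\int[mu]_x (`|(EFin \o (g \_ D)) x| `^ p) = \int[mu]_x ((g \_ D) x `^ p)%:E)%E.
  by apply: eq_integral => x _ /=; rewrite ger0_norm.
apply: ge0_le_integral => //.
- by move=> x _; rewrite lee_fin powR_ge0.
- apply/measurable_EFinP; apply: (measurableT_comp (measurable_powR _)).
  by apply/(measurable_restrictT _ mD); exact: measurable_funTS.
- by apply/measurable_EFinP; apply: (measurableT_comp (measurable_powR _) mg).
move=> x _ /=; rewrite lee_fin ge0_ler_powR ?nnegrE ?(ltW p0)//.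
by rewrite patchE; case: ifP.
Qed.

Lemma integral_lt_of_Lp_norm_lt (g : 'rV[R]_n -> R) (k : R) : 0 < k ->
  (forall x, 0 <= g x) -> (Lp_norm p%:E setT g < k%:E)%E ->
  (\int[mu]_x (g x `^ p)%:E < (k `^ p)%:E)%E.
Proof.
move=> k0 g0 gk.
have -> : (\int[mu]_x (g x `^ p)%:E = \int[mu]_x (`|(EFin \o (g \_ setT)) x| `^ p))%E.
  by apply: eq_integral => x _ /=; rewrite patchT ?inE// ger0_norm.
rewrite -powR_Lnorm ?gt_eqF// -poweR_EFin.
apply: ltr_poweR => //; exact: Lnorm_ge0.
Qed.

(** A function that oscillates no more than the cutoff on the admissible pairs inherits its
    gradient. The same [N] serves every [Omega], [z] and [r]. *)
Lemma Mball_norm_small (e : R) : 0 < e -> exists2 N, (0 < N)%N &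
  forall (Omega : set 'rV[R]_n) (z : 'rV[R]_n) (r : R) (v : 'rV[R]_n -> R),
  open Omega -> 0 < r ->
  (forall x y, Omega x -> Omega y ->
    ((eucl_dist x y)%:E < (2^-1)%:E * dist_boundary Omega x)%E ->
    `|v x - v y| <= `|log_cutoff N z r x - log_cutoff N z r y|) ->
  (Mball_norm s p%:E Omega v <= e%:E)%E.
Proof.
move=> e0; have [N N0 Ne] := log_cutoff_energy_small (powR_gt0 p e0).
exists N => // Omega z r v oO r0 vL.
have mg := log_cutoff_gradient_measurable s N z r n0.
have g0 := log_cutoff_gradient_ge0 z r s0 N0.
apply: (@le_trans _ _ (Lp_norm p%:E Omega (log_cutoff_gradient s N z r))).
  apply: ereal_inf_lbound; exists (log_cutoff_gradient s N z r) => //; split=> //.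
    exact: measurable_funTS.
  exists set0; split=> //.
  move=> x y [Ox _] [Oy _] xy; apply: (le_trans (vL _ _ Ox Oy xy)).
  by rewrite eucl_distE; exact: log_cutoff_le.
apply: Lp_norm_le => //; first exact: ltW.
by apply: (le_trans (log_cutoff_energy _ n0 s0 N0 r0)); rewrite lee_fin.
Qed.

End capacity.

(** * Separation in extension domains *)

Section separation.
Variables (R : realType) (n : nat).
Hypothesis n2 : (2 <= n)%N.

Let n0 : (0 < n)%N. Proof. exact: ltnW. Qed.

Lemma dist_boundaryT (x : 'rV[R]_n) : dist_boundary setT x = +oo%E.
Proof. by rewrite /dist_boundary interiorT setDT image_set0 ereal_inf0. Qed.

(** The common contradiction object for both LLC conditions. The scale [h] of the spheres is
    separate from the cutoff radius [r], since the spheres lie inside the cutoff zone's inner ball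
    in one case and beyond its outer radius in the other. *)
Definition separating_cutoff (Omega : set 'rV[R]_n) (N : nat) (z : 'rV[R]_n)
    (h r : R) (v : 'rV[R]_n -> R) : Prop :=
  [/\ measurable_on Omega v,
      forall x y, Omega x -> Omega y ->
        ((eucl_dist x y)%:E < (2^-1)%:E * dist_boundary Omega x)%E ->
        `|v x - v y| <= `|log_cutoff N z r x - log_cutoff N z r y|,
      forall t, 2 * h < t < 4 * h ->
        exists2 w, nrm (w - z) = t & \forall x \near w, Omega x /\ v x = 1 &
      forall t, 2 * h < t < 4 * h ->
        exists2 w, nrm (w - z) = t & \forall x \near w, Omega x /\ v x = 0].

Lemma extension_domain_no_separating_cutoff (s : R) (Omega : set 'rV[R]_n) :
  0 < s -> s <= 1 -> open Omega -> Mball_extension_domain s (n%:R / s)%:E Omega ->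
  exists2 N, (0 < N)%N & forall z h r v, 0 < h -> 0 < r ->
    ~ separating_cutoff Omega N z h r v.
Proof.
move=> s0 s1 oO [_ [C [C0 hC]]].
have [K K0 HK] := @loewner_lower_bound R n s n0 s0 s1.
pose kappa := (2 * K)^-1.
have k0 : 0 < kappa by rewrite invr_gt0 mulr_gt0.
(* After the extension constant [C] the norm is at most [kappa / 2]; the slack below [kappa] pays
   for the two infima, while [kappa * K = 1/2] contradicts the lower bound. *)
have e0 : 0 < kappa / (2 * C) by rewrite divr_gt0// mulr_gt0.
have [N N0 HN] := Mball_norm_small n2 s0 s1 e0.
exists N => // z h r v h0 r0 [mv vL v1 v0].
have ve := HN _ _ _ _ oO r0 vL.
have Mv : Mball s (n%:R / s)%:E Omega v by split=> //; exact: le_lt_trans ve (ltry _).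
have restr : (Mball_restr_norm s (n%:R / s)%:E Omega v < kappa%:E)%E.
  apply: (le_lt_trans (hC v Mv).2).
  apply: (@le_lt_trans _ _ (C%:E * (kappa / (2 * C))%:E)%E).
    by apply: lee_wpmul2l => //; rewrite lee_fin ltW.
  rewrite -EFinM lte_fin (_ : C * (kappa / (2 * C)) = kappa / 2); last first.
    by field; rewrite gt_eqF.
  by lra.
have [_ [u [[mu' _] uv] <-] unorm] := ereal_inf_lt restr.
have [_ [g [g0 mg [E [_ E0 gE]]] <-] gnorm] := ereal_inf_lt unorm.
have g0' x : 0 <= g x by exact: g0.
have : 1 <= kappa * K.
  apply: (HK z h kappa u g E) => //.
  - move=> x y Ex Ey; rewrite -eucl_distE; apply: gE => //.
    by rewrite dist_boundaryT gt0_muley ?ltry// lte_fin invr_gt0.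
  - move=> t /v1[w wt w1]; exists w => //.
    by apply: filterS w1 => x [Ox <-]; exact: uv.
  - move=> t /v0[w wt w1]; exists w => //.
    by apply: filterS w1 => x [Ox <-]; exact: uv.
  - exact: integral_lt_of_Lp_norm_lt.
have -> : kappa * K = 2^-1 by rewrite /kappa; field; rewrite gt_eqF.
lra.
Qed.

Lemma measurable_on_cutoff (Omega U : set 'rV[R]_n) (f : 'rV[R]_n -> R) :
  open U -> measurable_fun setT (f : lebesgueRn R n -> R) ->
  measurable_on Omega (fun w => f w * \1_U w).
Proof.
move=> oU mf.
have mU : measurable_fun setT (\1_U : lebesgueRn R n -> R).
  by apply: measurable_indic; exact: measurable_open.
exact: (measurable_funTS (measurable_funM mf mU)).
Qed.

Variables (Omega : set 'rV[R]_n) (N : nat).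
Hypotheses (oO : open Omega) (cO : connected Omega) (N0 : (0 < N)%N).
Hypothesis noN : forall z h r v, 0 < h -> 0 < r ->
  ~ separating_cutoff Omega N z h r v.

(** The cutoff is 1 on the part of the component of [x] near [z] and decreases to 0 at the outer
    radius, where leaving [V] therefore causes no jump. *)
Lemma joined_in_ball z r x y : 0 < r -> Omega x -> Omega y ->
  nrm (x - z) < r -> nrm (y - z) < r ->
  joined_in (Omega `&` [set w | nrm (w - z) < 2 ^+ N * (2 * r)]) x y.
Proof.
move=> r0 Ox Oy xr yr; apply: contrapT => nxy.
set r2 := 2 ^+ N * (2 * r) in nxy *.
have rr2 : 2 * r <= r2 by rewrite /r2 ler_peMl ?exprn_ege1// ?ler1n// mulr_ge0// ltW.
set V := Omega `&` _ in nxy.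
have oV : open V.
  by apply: openI => //; apply: open_comp (@open_lt _ r2) => w _; exact: nrm_continuous.
pose U := path_component V x.
have oU : open U by exact: path_component_open.
pose L := log_cutoff N z (2 * r).
have L01 w : 0 <= L w <= 1 by apply: log_cutoff_itv => //; rewrite mulr_gt0.
pose v w := (1 - L w) * \1_U w.
pose W q := Omega `&` [set w | nrm (w - z) < q].
have WV : W (2 * r) `<=` V by move=> w [Ow wr]; split=> //; exact: lt_le_trans rr2.
have oW : open (W (2 * r)).
  by apply: openI => //; apply: open_comp (@open_lt _ (2 * r)) => w _; exact: nrm_continuous.
have vU w : U w -> v w = 1 - L w by move=> Uw; rewrite /v indicE mem_set// mulr1.
have vU0 w : ~ U w -> v w = 0 by move=> Uw; rewrite /v indicE memNset// mulr0.
(* The spheres have radii between [r] and [2 r], where [L = 0]. The component of [a] in the ball of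
   radius [2 r] must reach each of them, otherwise it would contain [b]. *)
have cross a b t : Omega a -> Omega b -> nrm (a - z) < r -> ~ joined_in V a b ->
    2 * (r / 2) < t < 4 * (r / 2) ->
    exists2 w, nrm (w - z) = t & \forall q \near w, joined_in (W (2 * r)) a q.
  move=> Oa Ob ar nab /andP[t1 t2].
  have at' : nrm (a - z) < t by lra.
  have tr : t < 2 * r by lra.
  have [ab|[w aw wt]] := path_component_crossing oO cO (@nrm_continuous _ _ z) at' tr Oa Ob.
    by exfalso; apply: nab; exact: joined_in_sub ab.
  exists w => //; have := path_component_open (x := a) oW; rewrite openE => /(_ w aw).
  by apply: filterS => q.
apply: (@noN z (r / 2) (2 * r) v); [by rewrite divr_gt0|by rewrite mulr_gt0|split].
- have mL : measurable_fun setT ((fun w => 1 - L w) : lebesgueRn R n -> R).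
    apply: measurable_funB; first exact: measurable_cst.
    exact: (log_cutoff_measurable N z (2 * r) n0).
  exact: (measurable_on_cutoff oU mL).
- move=> w w' Ow Ow' ww'.
  have out a : r2 <= nrm (a - z) -> L a = 1 /\ v a = 0.
    move=> ar; split; first by apply: log_cutoff1 => //; rewrite mulr_gt0.
    apply: vU0 => /joined_in_end[_ /=]; rewrite ltNge => /negP; exact.
  have vL0 a b : r2 <= nrm (a - z) -> `|v a - v b| <= `|L a - L b|.
    move=> /out[-> ->]; rewrite sub0r normrN.
    have /andP[Lb0 Lb1] := L01 b.
    have [Ub|Ub] := pselect (U b); first by rewrite vU.
    by rewrite vU0// normr0.
  have [wr|wr] := lerP r2 (nrm (w - z)); first exact: vL0.
  have [wr'|wr'] := lerP r2 (nrm (w' - z)).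
    by rewrite distrC [leRHS]distrC; exact: vL0.
  (* Both points lie in the outer ball, which is convex, and the segment stays in [Omega] because
     the pair is admissible. *)
  have ww : joined_in V w w'.
    apply: joined_in_segment => t t01; split.
      apply: (ball_subset_of_dist_boundary oO Ow _ ww'); first exact: sqrtr_ge0.
      rewrite addrC addKr nrmZ eucl_distE -(nrmN (w - w')) opprB.
      by case/andP: t01 => t0 t1; rewrite ger0_norm// ler_piMl// nrm_ge0.
    rewrite /= (_ : _ - z = (w - z) + t *: ((w' - z) - (w - z))).
      exact: nrm_segment_lt.
    by apply/rowP => i; rewrite !mxE; ring.
  have [Uw|Uw] := pselect (U w).
    have Uw' : U w' by exact: joined_in_trans ww.
    by rewrite !vU//; rewrite opprB addrC addrA subrK distrC.
  have Uw' : ~ U w'.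
    by move=> Uw'; apply: Uw; apply: joined_in_trans Uw' _; exact: joined_in_sym.
  by rewrite !vU0// subrr normr0.
- move=> t tr; have [w wt xw] := cross x y t Ox Oy xr nxy tr; exists w => //.
  apply: filterS xw => q xq; have [Oq qr] := joined_in_end xq; split=> //.
  rewrite vU; last exact: joined_in_sub xq.
  by rewrite /L log_cutoff0 ?subr0// ?mulr_gt0// ltW.
- have nyx : ~ joined_in V y x by move=> /joined_in_sym.
  move=> t tr; have [w wt yw] := cross y x t Oy Ox yr nyx tr; exists w => //.
  apply: filterS yw => q yq; have [Oq qr] := joined_in_end yq; split=> //.
  apply: vU0 => xq; apply: nxy; apply: joined_in_trans xq _.
  by apply: joined_in_sym; exact: joined_in_sub yq.
Qed.

(** The cutoff is reversed: it vanishes near [z] and is 1 beyond radius [r / 2] on the component of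
    [x], and the separating spheres have radii between [r / 2] and [r]. *)
Lemma joined_in_outside_ball z r x y : 0 < r -> Omega x -> Omega y ->
  r <= nrm (x - z) -> r <= nrm (y - z) ->
  joined_in (Omega `&` [set w | 2 ^- N * (r / 2) < nrm (w - z)]) x y.
Proof.
move=> r0 Ox Oy xr yr; apply: contrapT => nxy.
set r1 := 2 ^- N * (r / 2) in nxy *.
have r10 : 0 < r1 by rewrite mulr_gt0 ?divr_gt0// invr_gt0 exprn_gt0.
have r2E : 2 ^+ N * r1 = r / 2 by rewrite /r1 mulrA divff ?mul1r// expf_neq0.
have r12 : r1 <= r / 2 by rewrite -r2E ler_peMl ?exprn_ege1// ?ler1n// ltW.
have ogt c : open [set w : 'rV[R]_n | c < nrm (w - z)].
  by apply: open_comp (@open_gt _ c) => w _; exact: nrm_continuous.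
set V := Omega `&` _ in nxy.
have oV : open V by apply: openI.
pose U := path_component V x.
have oU : open U by exact: path_component_open.
pose L := log_cutoff N z r1.
have L01 w : 0 <= L w <= 1 by exact: log_cutoff_itv.
pose v w := L w * \1_U w.
(* The sign turns exteriors of balls into sublevel sets, as [path_component_crossing] requires. *)
pose W q := Omega `&` [set w | - nrm (w - z) < q].
have WV : W (- (r / 2)) `<=` V.
  by move=> w [Ow /=]; rewrite ltrN2 => wr; split=> //=; exact: le_lt_trans wr.
have oW : open (W (- (r / 2))).
  apply: openI => //; rewrite (_ : mkset _ = [set w | r / 2 < nrm (w - z)]) //.
  by apply/seteqP; split=> w /=; rewrite ltrN2.
have vU w : U w -> v w = L w by move=> Uw; rewrite /v indicE mem_set// mulr1.
have vU0 w : ~ U w -> v w = 0 by move=> Uw; rewrite /v indicE memNset// mulr0.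
have cN : continuous (fun w : 'rV[R]_n => - nrm (w - z)).
  move=> w; have cw : {for w, continuous (fun w : 'rV[R]_n => nrm (w - z))}.
    exact: nrm_continuous.
  exact: (continuousN cw).
have cross a b t : Omega a -> Omega b -> r <= nrm (a - z) -> ~ joined_in V a b ->
    2 * (r / 4) < t < 4 * (r / 4) ->
    exists2 w, nrm (w - z) = t & \forall q \near w, joined_in (W (- (r / 2))) a q.
  move=> Oa Ob ar nab /andP[t1 t2].
  have at' : - nrm (a - z) < - t by lra.
  have tr : - t < - (r / 2) by lra.
  have [ab|[w aw /oppr_inj wt]] := path_component_crossing oO cO cN at' tr Oa Ob.
    by exfalso; apply: nab; exact: joined_in_sub ab.
  exists w => //; have := path_component_open (x := a) oW; rewrite openE => /(_ w aw).
  by apply: filterS => q.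
apply: (@noN z (r / 4) r1 v) => //; [by rewrite divr_gt0|split].
- exact: (measurable_on_cutoff oU (log_cutoff_measurable N z r1 n0)).
- move=> w w' Ow Ow' ww'.
  have ins a : nrm (a - z) <= r1 -> L a = 0 /\ v a = 0.
    move=> ar; split; first by exact: log_cutoff0.
    apply: vU0 => /joined_in_end[_ /=]; rewrite ltNge => /negP; exact.
  have vL0 a b : nrm (a - z) <= r1 -> `|v a - v b| <= `|L a - L b|.
    move=> /ins[-> ->]; rewrite !sub0r !normrN.
    have [Ub|Ub] := pselect (U b); first by rewrite vU.
    by rewrite vU0// normr0.
  have [wr|wr] := lerP (nrm (w - z)) r1; first exact: vL0.
  have [wr'|wr'] := lerP (nrm (w' - z)) r1.
    by rewrite distrC [leRHS]distrC; exact: vL0.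
  (* The exterior of a ball is not convex, so an arc replaces the segment; it stays within
     [|w' - w|] of [w], hence in [Omega]. *)
  have ww : joined_in V w w'.
    apply: joined_in_sub (joined_in_ball_minus_ball n2 (ltW r10) wr wr') => q [qw qz].
    split=> //; apply: (ball_subset_of_dist_boundary oO Ow _ ww'); first exact: sqrtr_ge0.
    by rewrite eucl_distE -(nrmN (w - w')) opprB.
  have [Uw|Uw] := pselect (U w).
    have Uw' : U w' by exact: joined_in_trans ww.
    by rewrite !vU.
  have Uw' : ~ U w'.
    by move=> Uw'; apply: Uw; apply: joined_in_trans Uw' _; exact: joined_in_sym.
  by rewrite !vU0// subrr normr0.
- move=> t tr; have [w wt xw] := cross x y t Ox Oy xr nxy tr; exists w => //.
  apply: filterS xw => q xq; have [Oq /= qr] := joined_in_end xq; split=> //.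
  rewrite vU; last exact: joined_in_sub xq.
  by rewrite /L log_cutoff1// r2E -lerN2 ltW.
- have nyx : ~ joined_in V y x by move=> /joined_in_sym.
  move=> t tr; have [w wt yw] := cross y x t Oy Ox yr nyx tr; exists w => //.
  apply: filterS yw => q yq; have [Oq qr] := joined_in_end yq; split=> //.
  apply: vU0 => xq; apply: nxy; apply: joined_in_trans xq _.
  by apply: joined_in_sym; exact: joined_in_sub yq.
Qed.

End separation.

Unset Implicit Arguments.

Theorem theorem1p1 (R : realType) (n : nat) (hn : (2 <= n)%N)
    (Omega : set 'rV[R]_n) (hOmega : domain Omega)
    (hbounded : bounded_set Omega)
    (hext : exists s : R, 0 < s <= 1 /\
       Mball_extension_domain s ((n%:R / s)%:E) Omega) :
  LLC Omega.
Proof.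
have [oO cO _] := hOmega; have [s [/andP[s0 s1] ext]] := hext.
have [N N0 noN] := extension_domain_no_separating_cutoff hn s0 s1 oO ext.
have N2 : 0 < 2 ^+ N :> R by rewrite exprn_gt0.
(* This [b] satisfies both [2 ^ N * (2 r) = r / b] and [2 ^ -N * (r / 2) = b r]. *)
exists (2 ^+ N.+1)^-1; split.
  by rewrite invr_gt0 exprn_gt0//= invf_le1 ?exprn_gt0// exprn_ege1// ler1n.
move=> z r r0; split=> x y [Ox]; rewrite /eucl_ball/= ?eucl_distE => xr [Oy];
  rewrite ?eucl_distE => yr.
  apply: joined_in_sub (joined_in_ball hn oO cO N0 noN r0 Ox Oy xr yr) => w [Ow /= wr].
  by split=> //=; rewrite eucl_distE invrK exprS; apply: (lt_le_trans wr); lra.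
have {}xr : r <= nrm (x - z) by rewrite leNgt; apply/negP.
have {}yr : r <= nrm (y - z) by rewrite leNgt; apply/negP.
apply: joined_in_sub (joined_in_outside_ball hn oO cO N0 noN r0 Ox Oy xr yr) => w [Ow /= wr].
split=> //=; apply/negP; rewrite -leNgt eucl_distE; apply: le_trans (ltW wr).
by rewrite exprS invfM le_eqVlt; apply/orP; left; apply/eqP; ring.
Qed.
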